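(* Let $(M,g)$ be anti-de Sitter spacetime (AdS) with cosmological constant $\Lambda<0$ and let $k=\sqrt{-\Lambda/12}$. Let $S$ be a closed spacelike surface bounding a compact spacelike hypersurface $\Sigma$ in AdS, with null expansions satisfying $\theta_l>0$, $\theta_n<0$, $\theta_l\theta_n<-8k^2$, and suppose $S$ is generic in the $\Phi^A$ sense: the space of Dirac spinors $\Phi$ on $S$ solving $\overline m^a\nabla_a\Phi=0$ is four (complex) dimensional and a basis $\{\Phi^A\}_{A=1}^4$ is pointwise linearly independent at at least one point of $S$. Then the quasilocal mass vanishes: $m(S)=0$.
   Context: Setting. AdS is 4-dimensional, with signature $(-,+,+,+)$, satisfying $R_{ab}-\frac12Rg_{ab}+\Lambda g_{ab}=0$; $D_a$ is the Levi-Civita connection. $\{P,Q,X,Y\}$ is a (locally defined) orthonormal frame with $X,Y$ tangent to $S$, $Q$ the outward normal of $S$ in $\Sigma$, $P$ the future-directed timelike unit normal of $\Sigma$. The adapted Newman–Penrose tetrad is $l=\frac{1}{\sqrt2}(P+Q)$, $n=\frac1{\sqrt2}(P-Q)$, $m=\frac1{\sqrt2}(X+\mathrm{i}Y)$. With $\beta^{ab}=m^a\overline m^b+\overline m^am^b$, the null expansions are $\theta_l=\beta^{ab}D_al_b$ and $\theta_n=\beta^{ab}D_an_b$. $S$ is connected. Spinors. Gamma matrices satisfy $\gamma^a\gamma^b+\gamma^b\gamma^a=-2g^{ab}I$ and are in the Weyl representation $\gamma_a=\begin{bmatrix}0&\sigma_a\\ \tilde\sigma_a&0\end{bmatrix}$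 with $\sigma_a=(I,\sigma_1,\sigma_2,\sigma_3)$, $\tilde\sigma_a=(I,-\sigma_1,-\sigma_2,-\sigma_3)$ (lower index $a$; index $0$ refers to $P$); $\gamma^{abc}=\gamma^{[a}\gamma^b\gamma^{c]}$, $\overline\Psi=\Psi^\dagger\gamma^0$. Charge conjugation matrix: $\gamma_a^T=-C^{-1}\gamma_aC$, explicitly $C^{-1}=\begin{bmatrix}\varepsilon^{\alpha\beta}&0\\0&\varepsilon_{\dot\alpha\dot\beta}\end{bmatrix}$ with $\varepsilon^{12}=1$, $\varepsilon_{\dot1\dot2}=-1$. Modified connection: $\nabla_a\Psi=D_a\Psi+\mathrm{i}k\gamma_a\Psi$. With $\{\Phi^A\}$ a basis of solutions to $\overline m^a\nabla_a\Phi=0$ on $S$, define $$Q^{AB}=\int_S l_an_b\left(\overline{\Phi}^A\gamma^{abc}\nabla_c\Phi^B-\overline{\nabla_c\Phi^A}\,\gamma^{abc}\Phi^B\right)\mathrm{d}A,\qquad T^{AB}=(\Phi^A)^TC^{-1}\Phi^B,$$ where $T^{AB}$ is constant on $S$, and invertible when $S$ is generic in the $\Phi^A$ sense. The quasilocal mass is $m(S)=\frac{1}{16\pi}\sqrt{-\operatorname{tr}(QT^{-1}\overline Q\,\overline T^{-1})}$ (bars on matrices: entrywise complex conjugation). *)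

(* Defs.v *)
From HB Require Import structures.
From mathcomp Require Import all_boot all_order all_algebra.
From mathcomp Require Import all_classical all_reals all_analysis.
From mathcomp Require Import complex.
Set Implicit Arguments.
Unset Strict Implicit.
Unset Printing Implicit Defensive.
Import Order.TTheory GRing.Theory Num.Theory.
Import numFieldNormedType.Exports.
Local Open Scope classical_set_scope.
Local Open Scope complex_scope.
Local Open Scope ring_scope.

Section Smooth.
Context {R : realType}.

Fixpoint Cn (V W : normedModType R) (n : nat) (U : set V) (f : V -> W) : Prop :=
  match n with
  | 0%N => forall x, U x -> {for x, continuous f}
  | n'.+1 => (forall x, U x -> differentiable f x) /\
             (forall v : V, Cn n' U (fun x => 'D_v f x))
  end.

Definition smooth (V W : normedModType R) (U : set V) (f : V -> W) : Prop :=
  forall n, Cn n U f.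

End Smooth.

(* Anti-de Sitter spacetime, in the global coordinates (t, x1, x2, x3) with
   rho^2 = |x|^2 < 1 (no periodic identification of t). With
   ell = sqrt (-3 / Lam) its metric is
     g = - ((1 + rho^2) / (1 - rho^2))^2 dt^2
         + 4 ell^2 / (1 - rho^2)^2 (dx1^2 + dx2^2 + dx3^2),
   which is the static form -(1 + r^2/ell^2) dt^2 + dr^2/(1 + r^2/ell^2)
   + r^2 dOmega^2 after the substitution r = 2 ell rho / (1 - rho^2).
   Vectors are given by their coordinate components. *)
Section AdS.
Context {R : realType}.
Variable Lam : R.
Implicit Types (p v w : 'rV[R]_4) (V : 'rV[R]_4 -> 'rV[R]_4) (a b c d : 'I_4).

Definition adsk : R := Num.sqrt (- Lam / 12).

Definition rho2 p : R := \sum_(a < 4 | a != 0) p 0 a ^+ 2.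

Definition AdS : set 'rV[R]_4 := [set p | rho2 p < 1].

Definition metric p : 'M[R]_4 := \matrix_(a, b)
  (if a == b then
     if a == 0 then - ((1 + rho2 p) / (1 - rho2 p)) ^+ 2
     else 4 * (- 3 / Lam) / (1 - rho2 p) ^+ 2
   else 0).

Definition gdot p v w : R := (v *m metric p *m w^T) 0 0.

Definition coordv a : 'rV[R]_4 := delta_mx 0 a.

Definition christoffel p a b c : R :=
  2^-1 * \sum_(d < 4) invmx (metric p) a d *
    ('D_(coordv b) (fun q => metric q d c) p
     + 'D_(coordv c) (fun q => metric q b d) p
     - 'D_(coordv d) (fun q => metric q b c) p).

Definition covD V p v : 'rV[R]_4 :=
  'D_v V p
  + \row_a \sum_(b < 4) \sum_(c < 4) christoffel p a b c * v 0 b * V p 0 c.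

(* An orthonormal frame e_0, ..., e_3, since 1 / (2 ell) = adsk; the time
   orientation is that of e_0. *)
Definition frame a p : 'rV[R]_4 :=
  (if a == 0 then (1 - rho2 p) / (1 + rho2 p) else adsk * (1 - rho2 p))
    *: coordv a.

Definition eta a : R := if a == 0 then -1 else 1.

(* v_a and v^a with respect to the frame e_a *)
Definition lowc p v a : R := gdot p v (frame a p).
Definition upc p v a : R := eta a * lowc p v a.

(* omega_ab(v) = g(e_a, D_v e_b) *)
Definition spin_conn p v a b : R := gdot p (frame a p) (covD (frame b) p v).

Implicit Types (S Sigma N : set 'rV[R]_4).

(* Near each of its points, Sigma is carried by a diffeomorphism psi : U -> W
   (with inverse phi) onto the half-hyperplane x^0 = 0, x^3 >= 0 of W, the
   points of S being sent to the edge x^0 = x^3 = 0. *)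
Definition hypersurface_with_boundary Sigma S : Prop :=
  S `<=` Sigma /\
  forall p, Sigma p ->
    exists (U W : set 'rV[R]_4) (psi phi : 'rV[R]_4 -> 'rV[R]_4),
      [/\ [/\ open U, open W, U p, smooth U psi & smooth W phi],
          [/\ psi @` U = W, phi @` W = U,
              (forall q, U q -> phi (psi q) = q) &
              (forall x, W x -> psi (phi x) = x)],
          (forall q, U q ->
             (Sigma q <-> psi q 0 0 = 0 /\ 0 <= psi q 0 (inord 3))) &
          (forall q, U q -> (S q <-> psi q 0 0 = 0 /\ psi q 0 (inord 3) = 0))].

(* Velocities at p of curves which lie in N for small positive time: this is
   T_pS if N = S, T_pSigma if N = Sigma and p is interior, and the closed half
   of T_pSigma pointing into Sigma if N = Sigma and p is a boundary point. *)
Definition tangent_at N p v : Prop :=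
  exists c : R -> 'rV[R]_4,
    [/\ c 0 = p, is_derive (0 : R) (1 : R) c v & \forall t \near 0^'+, N (c t)].

Definition spacelike N : Prop :=
  forall p v, N p -> tangent_at N p v -> v != 0 -> 0 < gdot p v v.

Definition compact_spacelike_with_boundary Sigma S : Prop :=
  [/\ Sigma `<=` AdS, compact Sigma, hypersurface_with_boundary Sigma S &
      spacelike Sigma].

(* Fields on S are represented by fields that are smooth near S. Everything
   below only depends on their restriction to S: only derivatives in directions
   tangent to S survive the contractions with beta^ab, mbar^a and
   l_a n_b gamma^abc. *)
Definition smooth_near (W : normedModType R) S (f : 'rV[R]_4 -> W) : Prop :=
  exists U, [/\ open U, S `<=` U & smooth U f].

Definition future_unit_normal Sigma S (P : 'rV[R]_4 -> 'rV[R]_4) : Prop :=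
  smooth_near S P /\
  forall p, S p ->
    [/\ gdot p (P p) (P p) = -1, gdot p (P p) (coordv 0) < 0 &
        forall v, tangent_at Sigma p v -> gdot p (P p) v = 0].

Definition outward_unit_normal Sigma S (Q : 'rV[R]_4 -> 'rV[R]_4) : Prop :=
  smooth_near S Q /\
  forall p, S p ->
    [/\ gdot p (Q p) (Q p) = 1, tangent_at Sigma p (- Q p) &
        forall v, tangent_at S p v -> gdot p (Q p) v = 0].

(* X, Y complete P, Q to an orthonormal frame at p. The operator
   mbar^a nabla_a requires the frames (P, X, Y, Q) at the various points of S
   to have a common orientation; orient says which one it is. *)
Definition adapted S (P Q : 'rV[R]_4 -> 'rV[R]_4) (orient : bool)
    p (X Y : 'rV[R]_4) : Prop :=
  [/\ [/\ tangent_at S p X & tangent_at S p Y],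
      [/\ gdot p X X = 1, gdot p Y Y = 1 & gdot p X Y = 0] &
      0 < (-1) ^+ orient *
          \det (\matrix_(i < 4) nth 0 [:: P p; X; Y; Q p] i)].

Definition null_l (P Q : 'rV[R]_4 -> 'rV[R]_4) p : 'rV[R]_4 :=
  (Num.sqrt 2)^-1 *: (P p + Q p).
Definition null_n (P Q : 'rV[R]_4 -> 'rV[R]_4) p : 'rV[R]_4 :=
  (Num.sqrt 2)^-1 *: (P p - Q p).
(* frame components m^a of m = (X + i Y) / sqrt 2 *)
Definition null_m p (X Y : 'rV[R]_4) a : R[i] :=
  ((Num.sqrt 2)^-1)%:C * ((upc p X a)%:C + 'i%C * (upc p Y a)%:C).

(* beta^ab D_a V_b with beta^ab = m^a mbar^b + mbar^a m^b *)
Definition expansion V p (X Y : 'rV[R]_4) : R[i] :=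
  \sum_(a < 4) \sum_(b < 4)
    (null_m p X Y a * conjc (null_m p X Y b)
     + conjc (null_m p X Y a) * null_m p X Y b)
    * (lowc p (covD V p (frame a p)) b)%:C.

(* Spinor fields are given by their components in the global spin frame over
   the frames e_a. This is legitimate, although the adapted frames are only
   local, because the two are related by proper orthochronous Lorentz
   transformations (after a reflection of AdS if orient = true) and all the
   expressions below are invariant under those. *)
Definition mx2 (x y z t : R[i]) : 'M[R[i]]_2 :=
  \matrix_(i, j) (if i == 0 then if j == 0 then x else y
                  else if j == 0 then z else t).

Definition pauli a : 'M[R[i]]_2 :=
  nth 0 [:: mx2 1 0 0 1; mx2 0 1 1 0; mx2 0 (- 'i%C) 'i%C 0; mx2 1 0 0 (-1)] a.

(* gamma_a and gamma^a; sigma~_a = - eta_a sigma_a *)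
Definition gammal a : 'M[R[i]]_4 :=
  block_mx (0 : 'M[R[i]]_2) (pauli a) ((- eta a)%:C *: pauli a) (0 : 'M[R[i]]_2).
Definition gammau a : 'M[R[i]]_4 := (eta a)%:C *: gammal a.

Definition gamma3 a b c : 'M[R[i]]_4 :=
  6^-1 *: (gammau a *m gammau b *m gammau c + gammau b *m gammau c *m gammau a
         + gammau c *m gammau a *m gammau b - gammau b *m gammau a *m gammau c
         - gammau a *m gammau c *m gammau b - gammau c *m gammau b *m gammau a).

Definition Cinv : 'M[R[i]]_4 :=
  block_mx (mx2 0 1 (-1) 0) (0 : 'M[R[i]]_2) (0 : 'M[R[i]]_2) (mx2 0 (-1) 1 0).

Definition dirac_adj (psi : 'cV[R[i]]_4) : 'rV[R[i]]_4 :=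
  (map_mx (@conjc R) psi)^T *m gammau 0.

Implicit Types Psi : 'rV[R]_4 -> 'cV[R[i]]_4.

Definition spinor_field S Psi : Prop :=
  forall i, smooth_near S (fun p => complex.Re (Psi p i 0)) /\
            smooth_near S (fun p => complex.Im (Psi p i 0)).

Definition dspinor Psi p v : 'cV[R[i]]_4 :=
  \col_i ('D_v (fun q => complex.Re (Psi q i 0)) p
          +i* 'D_v (fun q => complex.Im (Psi q i 0)) p).

(* With {gamma^a, gamma^b} = - 2 g^ab the spin connection is
   - 1/4 omega_ab gamma^a gamma^b *)
Definition spinD Psi p v : 'cV[R[i]]_4 :=
  dspinor Psi p v
  - 4^-1 *: \sum_(a < 4) \sum_(b < 4)
      (spin_conn p v a b)%:C *: (gammau a *m gammau b *m Psi p).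

(* nabla_c Psi = D_c Psi + i k gamma_c Psi, frame index c *)
Definition nabla Psi p c : 'cV[R[i]]_4 :=
  spinD Psi p (frame c p) + ('i%C * adsk%:C) *: (gammal c *m Psi p).

Definition mbar_equation S (P Q : 'rV[R]_4 -> 'rV[R]_4) (orient : bool) Psi
    : Prop :=
  spinor_field S Psi /\
  forall p X Y, S p -> adapted S P Q orient p X Y ->
    \sum_(a < 4) conjc (null_m p X Y a) *: nabla Psi p a = 0.

(* Fields are compared on S only; the last clause is pointwise independence. *)
Definition generic_basis S (P Q : 'rV[R]_4 -> 'rV[R]_4) (orient : bool)
    (Phi : 'I_4 -> 'rV[R]_4 -> 'cV[R[i]]_4) : Prop :=
  [/\ forall A, mbar_equation S P Q orient (Phi A),
      forall z : 'I_4 -> R[i],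
        (forall p, S p -> \sum_(A < 4) z A *: Phi A p = 0) ->
        forall A, z A = 0,
      forall Psi, mbar_equation S P Q orient Psi ->
        exists z : 'I_4 -> R[i],
          forall p, S p -> Psi p = \sum_(A < 4) z A *: Phi A p &
      exists2 p, S p &
        forall z : 'I_4 -> R[i],
          \sum_(A < 4) z A *: Phi A p = 0 -> forall A, z A = 0].

Definition borel4 := g_sigma_algebraType (@open 'rV[R]_4).

Definition area_density (phi : R * R -> 'rV[R]_4) (u : R * R) : R :=
  let d1 := 'D_((1, 0) : R * R) phi u in
  let d2 := 'D_((0, 1) : R * R) phi u in
  Num.sqrt (gdot (phi u) d1 d1 * gdot (phi u) d2 d2 - gdot (phi u) d1 d2 ^+ 2).

Definition parametrization S (W : set (R * R)) (U : set 'rV[R]_4)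
    (phi : R * R -> 'rV[R]_4) : Prop :=
  [/\ open W, open U, smooth W phi, (forall u, W u -> 0 < area_density phi u) &
      {in W &, injective phi} /\ phi @` W = S `&` U].

(* The area form is the pullback of sqrt (det (induced metric)) du dv, and
   these local formulas determine mu. *)
Definition area_measure S (mu : {measure set borel4 -> \bar R}) : Prop :=
  mu (~` S) = 0%E /\
  forall (W : set (R * R)) (U : set 'rV[R]_4) (phi : R * R -> 'rV[R]_4),
    parametrization S W U phi ->
    forall B : set borel4, measurable B -> B `<=` U ->
      mu B = (\int[(@lebesgue_measure R \x @lebesgue_measure R)%E]_(u in
                  (W `&` phi @^-1` B)) (area_density phi u)%:E)%E.

Definition cintegral (mu : {measure set borel4 -> \bar R}) S
    (f : 'rV[R]_4 -> R[i]) : R[i] :=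
  Rintegral mu S (fun p => complex.Re (f p))
  +i* Rintegral mu S (fun p => complex.Im (f p)).

Definition Qmx S (mu : {measure set borel4 -> \bar R})
    (P Q : 'rV[R]_4 -> 'rV[R]_4) (Phi : 'I_4 -> 'rV[R]_4 -> 'cV[R[i]]_4)
    : 'M[R[i]]_4 :=
  \matrix_(A, B) cintegral mu S (fun p =>
    \sum_(a < 4) \sum_(b < 4) \sum_(c < 4)
      (lowc p (null_l P Q p) a * lowc p (null_n P Q p) b)%:C *
      (dirac_adj (Phi A p) *m gamma3 a b c *m nabla (Phi B) p c
       - dirac_adj (nabla (Phi A) p c) *m gamma3 a b c *m Phi B p) 0 0).

Definition Tmx (Phi : 'I_4 -> 'rV[R]_4 -> 'cV[R[i]]_4) p : 'M[R[i]]_4 :=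
  \matrix_(A, B) ((Phi A p)^T *m Cinv *m Phi B p) 0 0.

(* The matrix T is constant on S; p is the point of S where it is evaluated *)
Definition quasilocal_mass S (mu : {measure set borel4 -> \bar R})
    (P Q : 'rV[R]_4 -> 'rV[R]_4) (Phi : 'I_4 -> 'rV[R]_4 -> 'cV[R[i]]_4) p
    : R[i] :=
  let QQ := Qmx S mu P Q Phi in
  let T := Tmx Phi p in
  (16 * pi%:C)^-1 *
  sqrtC (- \tr (QQ *m invmx T *m map_mx (@conjc R) QQ
                *m invmx (map_mx (@conjc R) T))).

End AdS.

(* Main.v *)
Require Import Defs.
From HB Require Import structures.
From mathcomp Require Import all_boot all_order all_algebra.
From mathcomp Require Import all_classical all_reals all_analysis.
From mathcomp Require Import complex ring.
Set Implicit Arguments.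
Unset Strict Implicit.
Unset Printing Implicit Defensive.
Import Order.TTheory GRing.Theory Num.Theory.
Import numFieldNormedType.Exports.
Local Open Scope classical_set_scope.
Local Open Scope complex_scope.
Local Open Scope ring_scope.

(** AdS carries a four-dimensional space of Killing spinors, i.e. solutions of
    nabla_c eps = 0, namely
      eps = (1 - rho^2)^(-1/2) (1 - i x.gamma) exp(- i k t gamma_0) chi
    with chi constant, and they span the spinors at each point. Restricted to S
    they solve mbar^a nabla_a eps = 0, so by genericity each Phi^A agrees on S
    with a Killing spinor. Hence the derivatives of Phi^A in the directions
    tangent to S vanish; these are the only ones which enter
    l_a n_b gamma^abc nabla_c Phi, so that Q = 0 and m(S) = 0. *)

(* Unqualified, eta would be ssrfun's. *)
Local Notation eta := Defs.eta.

(** The fields [Phi A] are extended off [S] arbitrarily, so agreeing on [S] with a Killing spinor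
    does not make [nabla] of [Phi A] vanish in normal directions. What is proved instead is that
    nabla_c Phi^A has the form l_c A + n_c B; contracted with l_a n_b gamma^abc, both terms die by
    antisymmetry. Genericity is used at one point p0: every solution is on [S] a combination of the
    Phi^A, and independence at p0 makes its value there determine the coefficients. The Killing
    spinor with the value of Phi^B at p0 is a solution, hence equals Phi^B on [S]. With X = - i
    x.gamma one has X^2 = rho^2, so (1 + X)(1 - X) = 1 - rho^2 is positive on AdS. This makes the
    Killing spinors span at each point, and explains the factor (1 - rho^2)^(-1/2). The Killing
    equation is checked from the metric itself. As the metric is diagonal and static with radial
    coefficients, the spin connection along e_c is a multiple of the commutator of X and gamma_c,
    and the equation reduces to identities between two matrices with known squares and
    anticommutator. *)

(** * Calculus of functions that are n times differentiable on an open set *)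

Section CnTheory.
Context {R : realType} {V : normedModType R}.

(** The difference g - f vanishes near x, so the zero map satisfies the defining estimate of its
    differential; adding f back gives g. *)
Lemma near_eq_differentiable (W : normedModType R) (f g : V -> W) x :
  (\near x, f x = g x) -> differentiable f x -> differentiable g x.
Proof.
move=> fg df; have fgx := nbhs_singleton fg.
have -> : g = f + (g - f) by rewrite addrCA subrr addr0.
apply: differentiableD => //.
have h0 : (g - f) \o shift x = cst ((g - f) x) + \0 +o_ 0 id.
  apply/eqaddoP => _/posnumP[e]; rewrite near_simpl.
  have := fg; rewrite (near_shift 0) subr0 => fg0.
  near=> y; have /= -> : ((g - f) \o shift x - (cst ((g - f) x) + \0)) y = 0.
    rewrite /= !fctE /= fgx subrr addr0 subr0.
    by rewrite (_ : f (y + x) = g (y + x)) ?subrr //; exact: (near fg0 y).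
  by rewrite normr0 mulr_ge0.
have c0 : continuous (\0 : V -> W) by exact: cst_continuous.
have d0 := @diff_unique _ _ _ (g - f) \0 x c0 h0.
by apply/diff_locallyP; rewrite d0.
Unshelve. all: by end_near. Qed.

(** Derivative formulas are available only on the domain U. Openness turns equality on U into
    equality near each point, which passes to the derivatives and lets the induction go on. *)
Lemma Cn_congr (W : normedModType R) n U (f g : V -> W) : open U ->
  (forall x, U x -> f x = g x) -> Cn n U f -> Cn n U g.
Proof.
move=> oU; elim: n f g => [|n IHn] f g fg.
  move=> Cf x Ux; suff : g @ x --> g x by [].
  rewrite -(fg x Ux).
  apply: cvg_trans (Cf x Ux); apply: near_eq_cvg.
  by near=> y; apply: fg; near: y; exact: open_nbhs_nbhs.
move=> [df Df].
have nfg x : U x -> \near x, f x = g x.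
  by move=> Ux; near=> y; apply: fg; near: y; exact: open_nbhs_nbhs.
split=> [x Ux|v]; first exact: near_eq_differentiable (nfg x Ux) (df x Ux).
apply: IHn (Df v) => x Ux.
exact: near_eq_derive (nfg x Ux).
Unshelve. all: by end_near. Qed.

(** Serves the Leibniz rule: there the factor that is not differentiated is needed at one order less
    than it is given. *)
Lemma Cn_pred (W : normedModType R) n U (f : V -> W) : Cn n.+1 U f -> Cn n U f.
Proof.
elim: n f => [|n IHn] f [df Df].
  by move=> x Ux; exact: differentiable_continuous (df x Ux).
by split=> // v; exact: IHn.
Qed.

Lemma Cn_cst (W : normedModType R) n U (a : W) : Cn n U (cst a : V -> W).
Proof.
elim: n a => [|n IHn] a; first by move=> x _; exact: cst_continuous.
split=> // v.
by have -> : (fun x => 'D_v (cst a) x) = cst (0 : W)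
  by apply/funext => x; rewrite derive_cst.
Qed.

Lemma CnD (W : normedModType R) n U (f g : V -> W) : open U ->
  Cn n U f -> Cn n U g -> Cn n U (fun x => f x + g x).
Proof.
move=> oU; elim: n f g => [|n IHn] f g.
  by move=> Cf Cg x Ux; apply: cvgD; [exact: Cf|exact: Cg].
move=> [df Df] [dg Dg]; split=> [x Ux|v].
  by apply: differentiableD; [exact: df|exact: dg].
apply: Cn_congr (IHn _ _ (Df v) (Dg v)) => // x Ux.
by rewrite -deriveD //; apply: diff_derivable; [exact: df|exact: dg].
Qed.

Lemma Cn_sum (W : normedModType R) m n U (P : pred 'I_m)
    (f : 'I_m -> V -> W) : open U ->
  (forall i, Cn n U (f i)) -> Cn n U (fun x => \sum_(i < m | P i) f i x).
Proof.
move=> oU Cf; elim: (index_enum _) => [|i s IHs].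
  rewrite (_ : (fun _ => _) = cst 0); first exact: Cn_cst.
  by apply/funext => x; rewrite big_nil.
have [Pi|nPi] := boolP (P i).
  rewrite (_ : (fun _ => _) = fun x => f i x + \sum_(i <- s | P i) f i x).
    exact: CnD.
  by apply/funext => x; rewrite big_cons Pi.
rewrite (_ : (fun _ => _) = fun x => \sum_(i <- s | P i) f i x) //.
by apply/funext => x; rewrite big_cons (negbTE nPi).
Qed.

Lemma CnM n U (f g : V -> R) : open U ->
  Cn n U f -> Cn n U g -> Cn n U (fun x => f x * g x).
Proof.
move=> oU; elim: n f g => [|n IHn] f g.
  by move=> Cf Cg x Ux; apply: cvgM; [exact: Cf|exact: Cg].
move=> Cf Cg; have [df Df] := Cf; have [dg Dg] := Cg; split=> [x Ux|v].
  by apply: differentiableM; [exact: df|exact: dg].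
apply: Cn_congr (CnD oU (IHn _ _ (Cn_pred Cf) (Dg v))
                        (IHn _ _ (Cn_pred Cg) (Df v))) => // x Ux.
by rewrite -deriveM //; apply: diff_derivable; [exact: df|exact: dg].
Qed.

Lemma differentiable_derive_comp (f : V -> R) (g : R -> R) x v dg :
  differentiable f x -> is_derive (f x) 1 g dg ->
  differentiable (g \o f) x /\ 'D_v (g \o f) x = dg * 'D_v f x.
Proof.
move=> df [gd gE].
have dgx : differentiable g (f x) by exact/derivable1_diffP.
have dgf : differentiable (g \o f) x by exact: differentiable_comp.
split=> //; rewrite deriveE // diff_comp //= diff1E // derive1E gE.
by rewrite -deriveE // mulrC.
Qed.

End CnTheory.

(** * Smoothness and derivatives of the scalar functions entering the Killing spinors *)

Section AdSFunctions.
Context {R : realType} (Lam : R).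
Implicit Types (p v : 'rV[R]_4) (a b c : 'I_4) (U : set 'rV[R]_4).

Lemma differentiable_entry a p : differentiable (fun q : 'rV[R]_4 => q 0 a) p.
Proof. exact: differentiable_coord. Qed.

Lemma is_derive_entry a p v :
  is_derive p v (fun q : 'rV[R]_4 => q 0 a) (v 0 a).
Proof.
split; first exact/diff_derivable/differentiable_entry.
have dv : derivable (@id 'rV[R]_4) p v by exact: derivable_id.
have /matrixP/(_ 0 a) := derive_mx dv.
by rewrite derive_id mxE => ->.
Qed.

Lemma Cn_entry a n U : Cn n U (fun q : 'rV[R]_4 => q 0 a).
Proof.
case: n => [|n].
  by move=> x _; exact/differentiable_continuous/differentiable_entry.
split=> [x _|v]; first exact: differentiable_entry.
rewrite (_ : (fun _ => _) = cst (v 0 a)); first exact: Cn_cst.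
by apply/funext => x; rewrite (derive_val (is_derive := is_derive_entry a x v)).
Qed.

Definition xdot p v : R := \sum_(a < 4 | a != 0) p 0 a * v 0 a.

Lemma rho2E p : rho2 p = xdot p p.
Proof. by apply: eq_bigr => a _; rewrite expr2. Qed.

Lemma Cn_rho2 n U : open U -> Cn n U (@rho2 R).
Proof.
move=> oU; rewrite (_ : @rho2 R = fun p => xdot p p) ?funeqE; last exact: rho2E.
by apply: Cn_sum => // a; apply: CnM => //; exact: Cn_entry.
Qed.

Lemma differentiable_rho2 p : differentiable (@rho2 R) p.
Proof. by have [d _] := Cn_rho2 1 openT; exact: d. Qed.

Lemma is_derive_rho2 p v : is_derive p v (@rho2 R) (2 * xdot p v).
Proof.
have Da a : is_derive p v (fun q : 'rV[R]_4 => if a != 0 then q 0 a ^+ 2 else 0)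
    (if a != 0 then 2 * (p 0 a * v 0 a) else 0).
  case: ifP => _; last exact: is_derive_cst.
  apply: is_derive_eq (@is_deriveX _ _ _ 2 p v _ (is_derive_entry a p v)) _.
  by rewrite expr1 /GRing.scale /= mulrA.
have -> : @rho2 R = \sum_(a < 4)
    (fun q : 'rV[R]_4 => if a != 0 then q 0 a ^+ 2 else 0).
  by apply/funext => q; rewrite fct_sumE /rho2 big_mkcond.
by apply: is_derive_eq (is_derive_sum Da) _; rewrite -big_mkcond mulr_sumr.
Qed.

Lemma open_AdS : open (@AdS R).
Proof.
rewrite (_ : AdS = (@rho2 R) @^-1` [set x | x < 1]) //.
apply: open_comp; last exact: open_lt.
by move=> p _; exact/differentiable_continuous/differentiable_rho2.
Qed.

Definition conf p : R := 1 - rho2 p.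

Lemma conf_gt0 p : AdS p -> 0 < conf p.
Proof. by rewrite /AdS /= subr_gt0. Qed.

Lemma rho2_ge0 p : 0 <= rho2 p.
Proof. by apply: sumr_ge0 => a _; exact: sqr_ge0. Qed.

Lemma is_derive_conf p v : is_derive p v conf (- (2 * xdot p v)).
Proof.
have -> : conf = cst 1 - @rho2 R by [].
have D1 : is_derive p v (cst (1 : R)) 0 by exact: is_derive_cst.
by apply: is_derive_eq (is_deriveB D1 (is_derive_rho2 p v)) _; rewrite sub0r.
Qed.

Lemma differentiable_conf p : differentiable conf p.
Proof.
have -> : conf = cst 1 - @rho2 R by [].
by apply: differentiableB; [exact: differentiable_cst|
  exact: differentiable_rho2].
Qed.

Definition sconf p : R := (Num.sqrt (conf p))^-1.

Lemma sconf2 p : AdS p -> conf p * sconf p ^+ 2 = 1.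
Proof.
move=> /conf_gt0 u0; rewrite /sconf exprVn sqr_sqrtr ?ltW // divff //.
exact: lt0r_neq0.
Qed.

Lemma sconf_derive p v : AdS p ->
  differentiable sconf p /\ 'D_v sconf p = xdot p v * sconf p ^+ 3.
Proof.
move=> Ap; have u0 := conf_gt0 Ap.
have su0 : Num.sqrt (conf p) != 0 by rewrite lt0r_neq0 // sqrtr_gt0.
have [d1 D1] := differentiable_derive_comp v (differentiable_conf p)
  (is_derive1_sqrt u0).
have D2 : is_derive (Num.sqrt (conf p)) 1 (fun y : R => y^-1)
    (- (Num.sqrt (conf p)) ^- 2).
  split; first exact: derivableV.
  by rewrite deriveV // derive_id /GRing.scale /= mulr1.
have [d2 D2E] := differentiable_derive_comp v d1 D2.
split=> //; rewrite /sconf (_ : 'D_v _ p =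
  'D_v ((fun y : R => y^-1) \o (Num.sqrt \o conf)) p) //.
rewrite D2E D1 (derive_val (is_derive := is_derive_conf p v)).
by field; rewrite su0.
Qed.

(** The derivative of [sconf] is a polynomial in [sconf] and the coordinates, so regularity of order
    n yields order n + 1. *)
Lemma Cn_sconf n : Cn n (@AdS R) sconf.
Proof.
elim: n => [|n IHn].
  by move=> p /(sconf_derive 0)[d _]; exact: differentiable_continuous.
split=> [p /(sconf_derive 0)[] //|v].
apply: (@Cn_congr _ _ _ _ _ (fun p => xdot p v * (sconf p * (sconf p * sconf
  p)))).
- exact: open_AdS.
- by move=> p /(sconf_derive v)[_ ->]; rewrite 2!exprS expr1.
have oA := open_AdS.
do 3?[apply: CnM => //]; apply: Cn_sum => // a; apply: CnM => //.
  exact: Cn_entry.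
exact: Cn_cst.
Qed.

Definition tcos p : R := cos (adsk Lam * p 0 0).
Definition tsin p : R := sin (adsk Lam * p 0 0).

Let is_derive_time p v :
  is_derive p v (fun q : 'rV[R]_4 => adsk Lam * q 0 0) (adsk Lam * v 0 0).
Proof. exact: (is_deriveZ _ (is_derive_entry 0 p v)). Qed.

Let differentiable_time p :
  differentiable (fun q : 'rV[R]_4 => adsk Lam * q 0 0) p.
Proof. exact: (differentiableZ _ (differentiable_entry 0 p)). Qed.

Lemma tcos_derive p v : differentiable tcos p /\
  'D_v tcos p = - (adsk Lam * v 0 0 * tsin p).
Proof.
have [d D] := differentiable_derive_comp v (differentiable_time p)
  (is_derive_cos _).
by split=> //; rewrite D (derive_val (is_derive := is_derive_time p v)) mulNr
  mulrC.
Qed.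

Lemma tsin_derive p v : differentiable tsin p /\
  'D_v tsin p = adsk Lam * v 0 0 * tcos p.
Proof.
have [d D] := differentiable_derive_comp v (differentiable_time p)
  (is_derive_sin _).
by split=> //; rewrite D (derive_val (is_derive := is_derive_time p v)) mulrC.
Qed.

(** The induction is joint because each function is, up to a constant, the derivative of the
    other. *)
Lemma Cn_tcos_tsin n U : open U -> Cn n U tcos /\ Cn n U tsin.
Proof.
move=> oU; elim: n => [|n [IHc IHs]].
  split=> p _; apply: differentiable_continuous.
    by have [] := tcos_derive p 0.
  by have [] := tsin_derive p 0.
split; split=> [p _|v].
- by have [] := tcos_derive p 0.
- rewrite (_ : (fun _ => _) = fun p => - (adsk Lam * v 0 0) * tsin p).
    by apply: CnM => //; exact: Cn_cst.
  by apply/funext => p; have [_ ->] := tcos_derive p v; rewrite mulNr.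
- by have [] := tsin_derive p 0.
- rewrite (_ : (fun _ => _) = fun p => (adsk Lam * v 0 0) * tcos p).
    by apply: CnM => //; exact: Cn_cst.
  by apply/funext => p; have [_ ->] := tsin_derive p v.
Qed.

End AdSFunctions.

(** * Complex spinor fields through their real and imaginary parts *)

Section ComplexParts.
Context {R : realType}.
Implicit Types x y : R[i].

Lemma ReD x y : complex.Re (x + y) = complex.Re x + complex.Re y.
Proof. by case: x; case: y. Qed.

Lemma ImD x y : complex.Im (x + y) = complex.Im x + complex.Im y.
Proof. by case: x; case: y. Qed.

Lemma ReM x y :
  complex.Re (x * y) = complex.Re x * complex.Re y - complex.Im x * complex.Im
    y.
Proof. by case: x; case: y. Qed.

Lemma ImM x y :
  complex.Im (x * y) = complex.Re x * complex.Im y + complex.Im x * complex.Re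
    y.
Proof. by case: x => a b; case: y => c d /=; rewrite addrC. Qed.

Lemma Re_sum (I : finType) (F : I -> R[i]) :
  complex.Re (\sum_i F i) = \sum_i complex.Re (F i).
Proof. by apply: (big_morph (@complex.Re R) ReD). Qed.

Lemma Im_sum (I : finType) (F : I -> R[i]) :
  complex.Im (\sum_i F i) = \sum_i complex.Im (F i).
Proof. by apply: (big_morph (@complex.Im R) ImD). Qed.

End ComplexParts.

Section SpinorFields.
Context {R : realType}.
Implicit Types (F G : 'rV[R]_4 -> 'cV[R[i]]_4) (p v : 'rV[R]_4).

(** Differentiation is over the reals, so a spinor field is handled as eight real functions;
    [is_cderive] follows the same convention. *)
Definition cCn n (U : set 'rV[R]_4) F : Prop := forall i,
  Cn n U (fun p => complex.Re (F p i 0)) /\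
  Cn n U (fun p => complex.Im (F p i 0)).

Definition is_cderive p v F (dF : 'cV[R[i]]_4) : Prop := forall i,
  is_derive p v (fun q => complex.Re (F q i 0)) (complex.Re (dF i 0)) /\
  is_derive p v (fun q => complex.Im (F q i 0)) (complex.Im (dF i 0)).

Lemma dspinorE p v F dF : is_cderive p v F dF -> dspinor F p v = dF.
Proof.
move=> D; apply/matrixP => i j; rewrite ord1 mxE.
have [[_ ->] [_ ->]] := D i; by case: (dF i 0).
Qed.

Lemma is_cderive_cst p v (eta : 'cV[R[i]]_4) : is_cderive p v (cst eta) 0.
Proof. by move=> i; rewrite mxE; split; exact: is_derive_cst. Qed.

Lemma is_cderiveD p v F G dF dG :
  is_cderive p v F dF -> is_cderive p v G dG ->
  is_cderive p v (fun q => F q + G q) (dF + dG).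
Proof.
move=> DF DG i; have [RF IF] := DF i; have [RG IG] := DG i; split.
  rewrite mxE ReD; rewrite (_ : (fun _ => _) =
    (fun q => complex.Re (F q i 0)) + (fun q => complex.Re (G q i 0))).
    exact: is_deriveD.
  by apply/funext => q; rewrite mxE ReD.
rewrite mxE ImD; rewrite (_ : (fun _ => _) =
  (fun q => complex.Im (F q i 0)) + (fun q => complex.Im (G q i 0))).
  exact: is_deriveD.
by apply/funext => q; rewrite mxE ImD.
Qed.

Lemma is_cderive_sum p v (P : pred 'I_4) (F : 'I_4 -> _) dF :
  (forall a, is_cderive p v (F a) (dF a)) ->
  is_cderive p v (fun q => \sum_(a < 4 | P a) F a q) (\sum_(a < 4 | P a) dF a).
Proof.
move=> D; elim: (index_enum _) => [|a s IHs].
  rewrite big_nil (_ : (fun _ => _) = cst 0); first exact: is_cderive_cst.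
  by apply/funext => q; rewrite big_nil.
rewrite big_cons; have [Pa|nPa] := boolP (P a).
  rewrite (_ : (fun _ => _) = fun q => F a q + \sum_(a <- s | P a) F a q).
    exact: is_cderiveD.
  by apply/funext => q; rewrite big_cons Pa.
rewrite (_ : (fun _ => _) = fun q => \sum_(a <- s | P a) F a q) //.
by apply/funext => q; rewrite big_cons (negbTE nPa).
Qed.

Lemma is_cderiveZ p v (f : 'rV[R]_4 -> R) df F dF :
  is_derive p v f df -> is_cderive p v F dF ->
  is_cderive p v (fun q => (f q)%:C *: F q) (df%:C *: F p + (f p)%:C *: dF).
Proof.
move=> Df DF i; have [RF IF] := DF i; split.
  rewrite (_ : (fun _ => _) = f * (fun q => complex.Re (F q i 0))).
    apply: is_derive_eq (is_deriveM Df RF) _.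
    by rewrite !mxE ReD !ReM /= /GRing.scale /=; ring.
  by apply/funext => q; rewrite mxE ReM /= mul0r subr0.
rewrite (_ : (fun _ => _) = f * (fun q => complex.Im (F q i 0))).
  apply: is_derive_eq (is_deriveM Df IF) _.
  by rewrite !mxE ImD !ImM /= /GRing.scale /=; ring.
by apply/funext => q; rewrite mxE ImM /= mul0r addr0.
Qed.

Lemma is_cderive_mul p v (A : 'M[R[i]]_4) F dF :
  is_cderive p v F dF -> is_cderive p v (fun q => A *m F q) (A *m dF).
Proof.
move=> D i.
(* A complex matrix mixes real and imaginary parts, so each part of the product is a sum of real
   combinations of this shape. *)
have DRI j (a b : R) : is_derive p v
    (fun q => a * complex.Re (F q j 0) + b * complex.Im (F q j 0))
    (a * complex.Re (dF j 0) + b * complex.Im (dF j 0)).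
  have [RF IF] := D j.
  exact: is_deriveD (is_deriveZ a RF) (is_deriveZ b IF).
split.
  rewrite (_ : (fun _ => _) = \sum_(j < 4) (fun q : 'rV[R]_4 =>
    complex.Re (A i j) * complex.Re (F q j 0)
    + (- complex.Im (A i j)) * complex.Im (F q j 0))).
    apply: is_derive_eq (is_derive_sum (fun j => DRI j _ _)) _.
    by rewrite mxE Re_sum; apply: eq_bigr => j _; rewrite ReM mulNr.
  apply/funext => q; rewrite mxE Re_sum fct_sumE; apply: eq_bigr => j _.
  by rewrite ReM mulNr.
rewrite (_ : (fun _ => _) = \sum_(j < 4) (fun q : 'rV[R]_4 =>
  complex.Im (A i j) * complex.Re (F q j 0)
  + complex.Re (A i j) * complex.Im (F q j 0))).
  apply: is_derive_eq (is_derive_sum (fun j => DRI j _ _)) _.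
  by rewrite mxE Im_sum; apply: eq_bigr => j _; rewrite ImM addrC.
apply/funext => q; rewrite mxE Im_sum fct_sumE; apply: eq_bigr => j _.
by rewrite ImM addrC.
Qed.

Lemma cCn_cst n U (eta : 'cV[R[i]]_4) : cCn n U (cst eta).
Proof. by move=> i; split; exact: Cn_cst. Qed.

Lemma cCnD n U F G : open U -> cCn n U F -> cCn n U G ->
  cCn n U (fun p => F p + G p).
Proof.
move=> oU CF CG i; have [RF IF] := CF i; have [RG IG] := CG i; split.
  by apply: Cn_congr (CnD oU RF RG) => // p _; rewrite mxE ReD.
by apply: Cn_congr (CnD oU IF IG) => // p _; rewrite mxE ImD.
Qed.

Lemma cCn_sum n U (P : pred 'I_4) (F : 'I_4 -> _) : open U ->
  (forall a, cCn n U (F a)) -> cCn n U (fun p => \sum_(a < 4 | P a) F a p).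
Proof.
move=> oU CF i; split.
  apply: Cn_congr (Cn_sum P oU (fun a => (CF a i).1)) => // p _.
  rewrite summxE; elim/big_ind2 : _ => // x1 x2 y1 y2 -> ->.
  by rewrite ReD.
apply: Cn_congr (Cn_sum P oU (fun a => (CF a i).2)) => // p _.
rewrite summxE; elim/big_ind2 : _ => // x1 x2 y1 y2 -> ->.
by rewrite ImD.
Qed.

Lemma cCnZ n U (f : 'rV[R]_4 -> R) F : open U -> Cn n U f -> cCn n U F ->
  cCn n U (fun p => (f p)%:C *: F p).
Proof.
move=> oU Cf CF i; have [RF IF] := CF i; split.
  by apply: Cn_congr (CnM oU Cf RF) => // p _; rewrite mxE ReM /= mul0r subr0.
by apply: Cn_congr (CnM oU Cf IF) => // p _; rewrite mxE ImM /= mul0r addr0.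
Qed.

Lemma cCn_mul n U (A : 'M[R[i]]_4) F : open U -> cCn n U F ->
  cCn n U (fun p => A *m F p).
Proof.
move=> oU CF i.
have CRI j (a b : R) :
    Cn n U (fun q => a * complex.Re (F q j 0) + b * complex.Im (F q j 0)).
  have [RF IF] := CF j.
  by apply: CnD => //; apply: CnM => //; exact: Cn_cst.
split.
  apply: Cn_congr (Cn_sum xpredT oU (fun j => CRI j (complex.Re (A i j))
                                        (- complex.Im (A i j)))) => // p _.
  by rewrite mxE Re_sum; apply: eq_bigr => j _; rewrite ReM mulNr.
apply: Cn_congr (Cn_sum xpredT oU (fun j => CRI j (complex.Im (A i j))
                                        (complex.Re (A i j)))) => // p _.
by rewrite mxE Im_sum; apply: eq_bigr => j _; rewrite ImM addrC.
Qed.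

End SpinorFields.

(** * Clifford relations in the Weyl representation *)

Section Clifford.
Context {R : realType}.
Implicit Types a b c : 'I_4.

Lemma eta_sqr a : eta a * eta a = 1 :> R.
Proof. by rewrite /eta; case: ifP => _; rewrite ?mulrNN mulr1. Qed.

Lemma mx2M (x y z t x' y' z' t' : R[i]) : mx2 x y z t *m mx2 x' y' z' t' =
  mx2 (x * x' + y * z') (x * y' + y * t') (z * x' + t * z') (z * y' + t * t').
Proof.
by apply/matrixP => i j; rewrite !mxE !big_ord_recl big_ord0 addr0 !mxE /=;
  case: i => [[|[|]] // ii]; case: j => [[|[|]] // ij].
Qed.

Lemma mx2D (x y z t x' y' z' t' : R[i]) : mx2 x y z t + mx2 x' y' z' t' =
  mx2 (x + x') (y + y') (z + z') (t + t').
Proof. by apply/matrixP => i j; rewrite !mxE; do 2?case: ifP. Qed.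

Lemma mx2Z (c x y z t : R[i]) :
  c *: mx2 x y z t = mx2 (c * x) (c * y) (c * z) (c * t).
Proof. by apply/matrixP => i j; rewrite !mxE; do 2?case: ifP. Qed.

Lemma scalar_mx2 (c : R[i]) : c%:M = mx2 c 0 0 c.
Proof.
by apply/matrixP => i j; rewrite !mxE;
  case: i => [[|[|]] // ii]; case: j => [[|[|]] // ij].
Qed.

Lemma pauli_anticomm a b :
  (eta b : R)%:C *: (pauli a *m pauli b) + (eta a)%:C *: (pauli b *m pauli a)
  = ((2 * eta a) *+ (a == b))%:C%:M.
Proof.
have i2 : 'i%C * 'i%C = -1 :> R[i] by rewrite -expr2 sqr_i.
case: a => [[|[|[|[|]]]] // ia]; case: b => [[|[|[|[|]]]] // ib];
  rewrite /pauli /eta /= !mx2M !mx2Z !mx2D scalar_mx2 -?mulrnAr /=;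
  rewrite !(mulr0, mul0r, mulr1, mul1r, mulr1n, mulr0n, addr0, add0r, mulrN,
    mulNr, opprK, oppr0, i2, rmorphN, rmorphM, rmorph1, addNr, subrr, natrD,
    rmorphD, opprD, raddf0, rmorph_nat, (mulr_natl _ 2), (mulr2n)) /=; by [].
Qed.

(* In terms of - i gamma_a the Killing equation is D_c eps = k rgamma_c eps,
   without imaginary coefficients. *)
Fact rgamma_key : unit. Proof. by []. Qed.
Definition rgamma a : 'M[R[i]]_4 :=
  locked_with rgamma_key ((- 'i%C) *: gammal a).

Lemma rgammaE a : rgamma a = (- 'i%C) *: gammal a.
Proof. by rewrite /rgamma unlock. Qed.

(** The other off-diagonal block of the Clifford relation. Multiplying the first one by eta_a eta_b
    exchanges the two signs, since each eta squares to 1. *)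
Lemma pauli_tilde_anticomm a b :
  (eta a : R)%:C *: (pauli a *m pauli b) + (eta b)%:C *: (pauli b *m pauli a)
  = ((2 * eta a) *+ (a == b))%:C%:M.
Proof.
have := congr1 ( *:%R (eta a * eta b)%:C) (pauli_anticomm a b).
rewrite scalerDr !scalerA -!rmorphM -mulrA eta_sqr mulr1 mulrAC eta_sqr mul1r.
move=> ->; rewrite scale_scalar_mx -rmorphM.
by case: eqVneq => [->|_]; rewrite ?eta_sqr ?mul1r // mulr0.
Qed.

Lemma offdiag_anticomm (A B A' B' : 'M[R[i]]_2) (c : R[i]) :
  A *m B' + A' *m B = c%:M -> B *m A' + B' *m A = c%:M ->
  block_mx 0 A B 0 *m block_mx 0 A' B' 0 + block_mx 0 A' B' 0 *m block_mx 0 A B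
    0
  = c%:M :> 'M[R[i]]_(2 + 2).
Proof.
move=> AB BA; rewrite !mulmx_block !(mul0mx, mulmx0, add0r, addr0).
by rewrite add_block_mx AB BA !addr0 -scalar_mx_block.
Qed.

Lemma gammal_anticomm a b : gammal a *m gammal b + gammal b *m gammal a =
  (- ((2 * eta a) *+ (a == b)))%:C%:M :> 'M[R[i]]_4.
Proof.
apply: offdiag_anticomm.
  by rewrite -!scalemxAr !rmorphN !scaleNr -opprD pauli_anticomm.
by rewrite -!scalemxAl !rmorphN !scaleNr -opprD pauli_tilde_anticomm.
Qed.

Lemma rgamma_anticomm a b : rgamma a *m rgamma b + rgamma b *m rgamma a =
  ((2 * eta a) *+ (a == b))%:C%:M.
Proof.
rewrite !rgammaE -!scalemxAl -!scalemxAr !scalerA mulrNN -expr2 sqr_i !scaleN1r.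
by rewrite -opprD gammal_anticomm !rmorphN opprK.
Qed.

End Clifford.

(** * Levi-Civita connection of the diagonal AdS metric in the frame [frame] *)

Section LeviCivita.
Context {R : realType} (Lam : R) (hLam : Lam < 0).
Implicit Types (p v w : 'rV[R]_4) (a b c d : 'I_4).

Lemma invmx_uniq (F : comUnitRingType) n (A B : 'M[F]_n) :
  A *m B = 1%:M -> invmx A = B.
Proof.
move=> AB; have /andP[uA _] : (A \in unitmx) && (B \in unitmx).
  by rewrite -unitmx_mul AB unitmx1.
by rewrite -[RHS]mul1mx -(mulVmx uA) -mulmxA AB mulmx1.
Qed.

(** The scale factors of the orthonormal frame e_a = [lapse a] d/dx^a for all four indices, not only
    the lapse of the time slicing; the metric is eta_a / [lapse a]^2 on the diagonal. *)
Definition lapse a p : R :=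
  if a == 0 then (1 - rho2 p) / (1 + rho2 p) else adsk Lam * (1 - rho2 p).

Lemma frameE a p : frame Lam a p = lapse a p *: coordv a.
Proof. by []. Qed.

Lemma adsk_gt0 : 0 < adsk Lam.
Proof. by rewrite sqrtr_gt0 divr_gt0 // oppr_gt0. Qed.

Lemma adsk2 : adsk Lam ^+ 2 = - Lam / 12.
Proof. by rewrite sqr_sqrtr // divr_ge0 // oppr_ge0 ltW. Qed.

Lemma lapse_gt0 a p : AdS p -> 0 < lapse a p.
Proof.
move=> /conf_gt0 u0; rewrite /lapse; case: ifP => _.
  by rewrite divr_gt0 // ltr_wpDr // rho2_ge0.
by rewrite mulr_gt0 // adsk_gt0.
Qed.

Definition dlapse a p v : R :=
  if a == 0 then - (4 * xdot p v) / (1 + rho2 p) ^+ 2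
  else - (2 * adsk Lam * xdot p v).

Lemma dlapseZ a p v (r : R) : dlapse a p (r *: v) = r * dlapse a p v.
Proof.
have xZ : xdot p (r *: v) = r * xdot p v.
  by rewrite mulr_sumr; apply: eq_bigr => i _; rewrite mxE mulrCA.
by rewrite /dlapse xZ; case: ifP => _; ring.
Qed.

Lemma lapse_derive a p v :
  differentiable (lapse a) p /\ 'D_v (lapse a) p = dlapse a p v.
Proof.
have Du := is_derive_conf p v; have du := differentiable_conf p.
rewrite /lapse /dlapse; case: ifP => _; last first.
  split; first exact: differentiableZ.
  rewrite (_ : 'D_v _ p = 'D_v (adsk Lam *: conf) p) // deriveZ //.
  by rewrite (derive_val (is_derive := Du)) /GRing.scale /=; ring.
have r0 : 1 + rho2 p != 0 by rewrite lt0r_neq0 // ltr_wpDr // rho2_ge0.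
have dr : differentiable (cst 1 + @rho2 R) p.
  by apply: differentiableD; [exact: differentiable_cst|
    exact: differentiable_rho2].
have Dr : is_derive p v (cst 1 + @rho2 R) (0 + 2 * xdot p v).
  by apply: is_deriveD; exact: is_derive_rho2.
have dVr : differentiable (fun q => (1 + rho2 q)^-1) p.
  exact: (differentiableV dr).
split; first exact: (differentiableM du dVr).
rewrite (_ : 'D_v _ p = 'D_v (conf * (fun q => ((cst 1 + @rho2 R) q)^-1)) p) //.
rewrite deriveM //; last exact: diff_derivable.
rewrite deriveV // (derive_val (is_derive := Du)) (derive_val (is_derive :=
  Dr)).
by rewrite /conf /GRing.scale /= !fctE; field.
Qed.

Lemma metricE p a b :
  metric Lam p a b = (eta a / lapse a p ^+ 2) *+ (a == b).
Proof.
rewrite mxE; case: eqVneq => // _; rewrite mulr1n /eta /lapse.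
case: ifP => _; first by rewrite -exprVn invf_div mulN1r.
(* Spatial case: [adsk] is 1 / (2 ell), so the constant 4 ell^2 of the metric is the inverse of its
   square. *)
rewrite exprMn adsk2 mul1r [RHS]invfM; congr (_ * _).
by field; rewrite ?oppr_eq0 lt_eqF.
Qed.

Lemma gdotE p v w :
  gdot Lam p v w = \sum_a eta a / lapse a p ^+ 2 * v 0 a * w 0 a.
Proof.
rewrite /gdot mxE; apply: eq_bigr => a _; rewrite [w^T _ _]mxE; congr (_ * _).
rewrite mxE (bigD1 a) //= metricE eqxx mulr1n big1 ?addr0 1?mulrC // => b ba.
by rewrite metricE (negbTE ba) mulr0.
Qed.

Lemma invmx_metricE p a b : AdS p ->
  invmx (metric Lam p) a b = (eta a * lapse a p ^+ 2) *+ (a == b).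
Proof.
move=> Ap; rewrite (@invmx_uniq _ _ _
  (\matrix_(a, b) ((eta a * lapse a p ^+ 2) *+ (a == b)))) ?mxE //.
apply/matrixP => i j; rewrite [LHS]mxE (bigD1 i) //= big1 => [|k ki]; last
  first.
  by rewrite metricE eq_sym (negbTE ki) mul0r.
rewrite metricE eqxx mulr1n !mxE addr0 mulrnAr; congr (_ *+ _).
have l0 := lt0r_neq0 (lapse_gt0 i Ap).
by rewrite mulrACA eta_sqr mul1r mulVf // expf_neq0.
Qed.

Lemma derive_metric p v a b : AdS p ->
  'D_v (fun q => metric Lam q a b) p =
  (- 2 * eta a * dlapse a p v / lapse a p ^+ 3) *+ (a == b).
Proof.
move=> Ap; have [dl Dl] := lapse_derive a p v.
have l0 := lt0r_neq0 (lapse_gt0 a Ap).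
rewrite (_ : (fun _ => _) = fun q => (eta a / lapse a q ^+ 2) *+ (a == b)).
  2: by apply/funext => q; rewrite metricE.
case: eqVneq => _; last exact: derive_cst.
rewrite (_ : 'D_v _ p = 'D_v (eta a *: (fun q => ((lapse a ^+ 2) q)^-1)) p) //.
have dl2 : derivable (lapse a ^+ 2) p v.
  exact/diff_derivable/differentiableX.
have l20 : (lapse a ^+ 2) p != 0 by rewrite exprfctE expf_neq0.
rewrite deriveZ; last exact: derivableV.
rewrite deriveV // deriveX; last exact: diff_derivable.
by rewrite Dl /GRing.scale /= !exprfctE mulr1n; field.
Qed.

(** The inverse metric is diagonal, so only d = a contributes, and each metric derivative is
    supported on equal indices. *)
Lemma christoffelE p a b c : AdS p -> christoffel Lam p a b c =
  lapse a p ^+ 2 *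
  (- (dlapse a p (coordv b) / lapse a p ^+ 3) *+ (a == c)
   - (dlapse a p (coordv c) / lapse a p ^+ 3) *+ (a == b)
   + (eta a * eta b * dlapse b p (coordv a) / lapse b p ^+ 3) *+ (b == c)).
Proof.
move=> Ap; rewrite /christoffel (bigD1 a) //= big1 ?addr0; last first.
  by move=> d da; rewrite invmx_metricE // eq_sym (negbTE da) mul0r.
rewrite invmx_metricE // eqxx mulr1n !derive_metric //.
have -> : (- 2 * eta b * dlapse b p (coordv c) / lapse b p ^+ 3) *+ (b == a) =
  (- 2 * eta a * dlapse a p (coordv c) / lapse a p ^+ 3) *+ (a == b).
  by rewrite eq_sym; case: eqVneq => [->|].
rewrite -!(mulrA (-2 * _)) -(mulrA (eta a * eta b)).
move: (dlapse a p (coordv b) / _) (dlapse a p (coordv c) / _) => X Y.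
move: (dlapse b p (coordv a) / _) => Z.
(* The relation eta_a^2 = 1 enters by going through the two values of eta_a. *)
have [->|->] : eta a = 1 :> R \/ eta a = -1 :> R.
  by rewrite /eta; case: ifP; [right|left].
all: by case: (a == c); case: (a == b); case: (b == c);
  rewrite ?mulr1n ?mulr0n; field.
Qed.

Lemma gdot_frame p a v : AdS p ->
  gdot Lam p (frame Lam a p) v = eta a / lapse a p * v 0 a.
Proof.
move=> Ap; have l0 := lt0r_neq0 (lapse_gt0 a Ap).
rewrite gdotE (bigD1 a) //= big1 ?addr0 => [|b ba]; last first.
  by rewrite frameE !mxE (negbTE ba) !mulr0 mul0r.
by rewrite frameE !mxE !eqxx mulr1; field.
Qed.

Lemma derive_frame p b v :
  'D_v (frame Lam b) p = dlapse b p v *: coordv b.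
Proof.
have [dl Dl] := lapse_derive b p v.
rewrite (_ : frame Lam b = fun q => lapse b q *: coordv b) //.
rewrite deriveE; last exact: differentiableZl.
by rewrite diffZl // -deriveE // Dl.
Qed.

(** The classical formula for a diagonal metric: the coefficients are the derivatives e_a(log
    [lapse b]), present only when one of a, b is the direction c, and antisymmetrized in a and b. *)
Lemma spin_connE p c a b : AdS p ->
  spin_conn Lam p (frame Lam c p) a b =
  (eta b * (lapse a p * dlapse b p (coordv a) / lapse b p)) *+ (b == c)
  - (eta a * (lapse b p * dlapse a p (coordv b) / lapse a p)) *+ (a == c).
Proof.
move=> Ap; rewrite /spin_conn gdot_frame // /covD.
have la := lt0r_neq0 (lapse_gt0 a Ap); have lb := lt0r_neq0 (lapse_gt0 b Ap).
rewrite derive_frame [in LHS]mxE [X in _ * (_ + X) = _]mxE.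
(* Frame vectors are multiples of coordinate vectors, so the double sum of Christoffel symbols keeps
   a single term, with lower indices c and b. *)
rewrite (bigD1 c) //= [X in _ + (_ + X)]big1 ?addr0; last first.
  move=> d dc; apply: big1 => e _.
  by rewrite [frame _ c _]frameE !mxE (negbTE dc) !(mulr0, mul0r).
rewrite (bigD1 b) //= [X in _ + (_ + X)]big1 ?addr0; last first.
  by move=> e eb; rewrite [frame _ b _]frameE !mxE (negbTE eb) !(mulr0, mul0r).
rewrite !frameE dlapseZ !mxE !eqxx !mulr1 christoffelE // andTb (eq_sym c b).
have lc := lt0r_neq0 (lapse_gt0 c Ap).
have E x : eta x = 1 :> R \/ eta x = -1 :> R.
  by rewrite /eta; case: ifP; [right|left].
have [eab|_] := eqVneq a b; have [eac|_] := eqVneq a c;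
  have [ebc|_] := eqVneq b c; subst; rewrite ?mulr1n ?mulr0n;
  repeat match goal with |- context [Defs.eta ?x] => case: (E x) => -> end;
  by field; rewrite ?la ?lb ?lc.
Qed.

End LeviCivita.

(** * Killing spinors: construction, spanning property, and the equation nabla_c eps = 0 *)

Section KillingSpinors.
Context {R : realType} (Lam : R) (hLam : Lam < 0).
Implicit Types (p v : 'rV[R]_4) (a b c : 'I_4) (chi psi : 'cV[R[i]]_4).

(** This is the matrix - i x.gamma, with x the spatial part of p. *)
Definition dirX p : 'M[R[i]]_4 := \sum_(a < 4 | a != 0) (p 0 a)%:C *: rgamma a.

Lemma dirXZ p (r : R) : dirX (r *: p) = r%:C *: dirX p.
Proof.
rewrite scaler_sumr; apply: eq_bigr => a _.
by rewrite mxE rmorphM scalerA.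
Qed.

Lemma dirX_coordv c : dirX (coordv c) = if c == 0 then 0 else rgamma c.
Proof.
rewrite /dirX; case: eqVneq => [->|c0].
  by rewrite big1 // => a /negbTE a0; rewrite !mxE a0 scale0r.
rewrite (bigD1 c) //= big1 ?addr0 => [|a /andP[_ /negbTE ac]].
  by rewrite !mxE !eqxx scale1r.
by rewrite !mxE ac scale0r.
Qed.

Lemma xdot_coordv p c : xdot p (coordv c) = if c == 0 then 0 else p 0 c.
Proof.
rewrite /xdot; case: eqVneq => [->|c0].
  by rewrite big1 // => a /negbTE a0; rewrite !mxE a0 mulr0.
rewrite (bigD1 c) //= big1 ?addr0 => [|a /andP[_ /negbTE ac]].
  by rewrite !mxE !eqxx mulr1.
by rewrite !mxE ac mulr0.
Qed.

Lemma xdotZ p v (r : R) : xdot p (r *: v) = r * xdot p v.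
Proof. by rewrite mulr_sumr; apply: eq_bigr => i _; rewrite mxE mulrCA. Qed.

Lemma dirX_anticomm p c : dirX p *m rgamma c + rgamma c *m dirX p =
  (2 * xdot p (coordv c))%:C%:M.
Proof.
rewrite mulmx_suml mulmx_sumr -big_split /= mulr_sumr !rmorph_sum /=.
apply: eq_bigr => a a0.
rewrite -scalemxAl -(scalemxAr _ (rgamma c)) -scalerDr rgamma_anticomm
  scale_scalar_mx -rmorphM.
congr (_%:C%:M); rewrite !mxE /eta (negbTE a0) eqxx /= eq_sym.
by case: (c == a); rewrite ?mulr1n ?mulr0n; ring.
Qed.

Lemma half_scalar_mx (A : 'M[R[i]]_4) (r : R) :
  A + A = (2 * r)%:C%:M -> A = r%:C%:M.
Proof.
move=> AA; apply: (@scalerI _ _ (2 : R[i])); first by rewrite pnatr_eq0.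
rewrite scale_scalar_mx [LHS]scaler_nat mulr2n AA rmorphM; congr (_ * _)%:M.
exact: rmorph_nat.
Qed.

(** Expanding one copy of X on the left and one on the right turns X X + X X into a sum of
    anticommutators of X with the [rgamma a], each a scalar; halving gives the square. *)
Lemma dirX2 p : dirX p *m dirX p = (rho2 p)%:C%:M.
Proof.
apply: half_scalar_mx.
rewrite [X in X + _](_ : _ =
  \sum_(a < 4 | a != 0) (p 0 a)%:C *: (rgamma a *m dirX p)); last first.
  by rewrite mulmx_suml; apply: eq_bigr => a _; rewrite scalemxAl.
rewrite [X in _ + X](_ : _ =
  \sum_(a < 4 | a != 0) (p 0 a)%:C *: (dirX p *m rgamma a)); last first.
  by rewrite mulmx_sumr; apply: eq_bigr => a _; rewrite scalemxAr.
rewrite -big_split /= mulr_sumr !rmorph_sum; apply: eq_bigr => a a0 /=.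
rewrite -scalerDr addrC dirX_anticomm scale_scalar_mx.
by rewrite xdot_coordv (negbTE a0) -rmorphM; congr (_%:C%:M); ring.
Qed.

Lemma rgamma0_sqr : rgamma 0 *m rgamma 0 = - 1%:M :> 'M[R[i]]_4.
Proof.
have -> : - 1%:M = (- 1 : R)%:C%:M :> 'M[R[i]]_4 by rewrite !rmorphN.
by apply: half_scalar_mx; rewrite rgamma_anticomm eqxx mulr1n /eta eqxx.
Qed.

(** Euler's formula for exp(k t rgamma_0) chi, valid because rgamma_0 squares to -1; this is exp(- i
    k t gamma_0) chi. *)
Definition time_evol chi p : 'cV[R[i]]_4 :=
  (tcos Lam p)%:C *: chi + (tsin Lam p)%:C *: (rgamma 0 *m chi).

(** The product by X is spelled out as a sum of real functions times spinor fields, the form to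
    which the rules for smoothness and derivatives apply; [killingE] restores the matrix form. *)
Definition killing chi p : 'cV[R[i]]_4 :=
  (sconf p)%:C *: (time_evol chi p
    + \sum_(a < 4 | a != 0) (p 0 a)%:C *: (rgamma a *m time_evol chi p)).

Lemma killingE chi p : killing chi p =
  (sconf p)%:C *: (time_evol chi p + dirX p *m time_evol chi p).
Proof.
congr (_ *: (_ + _)); rewrite mulmx_suml; apply: eq_bigr => a _.
by rewrite scalemxAl.
Qed.

Lemma is_derive_sconf p v : AdS p ->
  is_derive p v sconf (xdot p v * sconf p ^+ 3).
Proof.
move=> /(sconf_derive v)[d D]; split=> //; exact: diff_derivable.
Qed.

Lemma is_cderive_time_evol chi p v : is_cderive p v (time_evol chi)
  ((adsk Lam * v 0 0)%:C *: (rgamma 0 *m time_evol chi p)).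
Proof.
have Dc : is_derive p v (tcos Lam) (- (adsk Lam * v 0 0 * tsin Lam p)).
  by have [d D] := tcos_derive Lam p v; split=> //; exact: diff_derivable.
have Ds : is_derive p v (tsin Lam) (adsk Lam * v 0 0 * tcos Lam p).
  by have [d D] := tsin_derive Lam p v; split=> //; exact: diff_derivable.
have := is_cderiveD (is_cderiveZ Dc (is_cderive_cst p v chi))
  (is_cderiveZ Ds (is_cderive_cst p v (rgamma 0 *m chi))).
congr is_cderive; rewrite !scaler0 !addr0 mulmxDr -!(scalemxAr _ (rgamma 0))
  mulmxA rgamma0_sqr.
rewrite mulNmx mul1mx scalerN scalerDr scalerN !scalerA -!rmorphM rmorphN.
by rewrite scaleNr addrC.
Qed.

Lemma is_cderive_killing chi p v : AdS p ->
  let zeta := time_evol chi p in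
  let dzeta := (adsk Lam * v 0 0)%:C *: (rgamma 0 *m zeta) in
  is_cderive p v (killing chi)
    ((xdot p v * sconf p ^+ 3)%:C *: (zeta + dirX p *m zeta)
     + (sconf p)%:C *: (dzeta + (dirX v *m zeta + dirX p *m dzeta))).
Proof.
move=> Ap zeta dzeta; have Dz := is_cderive_time_evol chi p v.
have := is_cderiveZ (is_derive_sconf v Ap) (is_cderiveD Dz
  (is_cderive_sum (fun a => a != 0) (fun a => is_cderiveZ
    (is_derive_entry a p v) (is_cderive_mul (rgamma a) Dz)))).
congr is_cderive; congr (_ *: (_ + _) + _ *: (_ + _)).
  by rewrite mulmx_suml; apply: eq_bigr => a _; rewrite scalemxAl.
rewrite big_split /= !mulmx_suml; congr (_ + _); apply: eq_bigr => a _;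
  by rewrite scalemxAl.
Qed.

Lemma cCn_killing chi n : cCn n (@AdS R) (killing chi).
Proof.
have oA := @open_AdS R; have [Cc Cs] := Cn_tcos_tsin Lam n oA.
have Cz : cCn n AdS (time_evol chi).
  by apply: cCnD => //; apply: cCnZ => //; exact: cCn_cst.
apply: cCnZ => //; first exact: Cn_sconf.
apply: cCnD => //; apply: cCn_sum => // a; apply: cCnZ => //.
  exact: Cn_entry.
exact: cCn_mul.
Qed.

(** The rotation by the opposite angle inverts the time evolution: the product of the two is cos^2 +
    sin^2. *)
Lemma time_evolK p (z : 'cV[R[i]]_4) :
  time_evol ((tcos Lam p)%:C *: z - (tsin Lam p)%:C *: (rgamma 0 *m z)) p = z.
Proof.
rewrite /time_evol mulmxBr -!(scalemxAr _ (rgamma 0)) mulmxA rgamma0_sqr mulNmx.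
rewrite mul1mx; move: (rgamma 0 *m z) => w.
have cs : (tcos Lam p)%:C ^+ 2 + (tsin Lam p)%:C ^+ 2 = 1.
  by rewrite -!rmorphXn -rmorphD cos2Dsin2.
apply/matrixP => i j; rewrite !mxE -[RHS]mul1r -cs; ring.
Qed.

Lemma killing_onto p psi : AdS p -> exists chi, killing chi p = psi.
Proof.
(* This z solves [sconf p] (1 + X) z = psi, because (1 + X)(1 - X) = 1 - rho^2 and [sconf p]^2 is
   the inverse of that scalar. The witness below then undoes the time evolution. *)
move=> Ap; pose z := (sconf p)%:C *: (psi - dirX p *m psi).
exists ((tcos Lam p)%:C *: z - (tsin Lam p)%:C *: (rgamma 0 *m z)).
have tz := time_evolK p z.
rewrite killingE tz /z -(scalemxAr _ (dirX p)) mulmxBr mulmxA dirX2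
  mul_scalar_mx.
have cs : (1 - (rho2 p)%:C) * (sconf p)%:C ^+ 2 = 1.
  by rewrite -(rmorph1 (real_complex R)) -rmorphB -rmorphXn -rmorphM sconf2.
move: (dirX p *m psi) => y.
by apply/matrixP => i j; rewrite !mxE -[RHS]mul1r -cs; ring.
Qed.

(** The proportionality factor in e_a(log [lapse c]) = [spin_factor c] x^a for spatial a; it exists
    because the scale factors depend on rho^2 alone. *)
Definition spin_factor c p : R :=
  if c == 0 then - (4 * adsk Lam) / (1 + rho2 p) else - (2 * adsk Lam).

Lemma lapse_dlapse p a c : AdS p ->
  lapse Lam a p * dlapse Lam c p (coordv a) / lapse Lam c p =
  if a == 0 then 0 else spin_factor c p * p 0 a.
Proof.
move=> Ap; have u0 : 1 - rho2 p != 0 by rewrite lt0r_neq0 // conf_gt0.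
have r0 : 1 + rho2 p != 0 by rewrite lt0r_neq0 // ltr_wpDr // rho2_ge0.
have k0 : adsk Lam != 0 by rewrite lt0r_neq0 // adsk_gt0.
rewrite /spin_factor /dlapse xdot_coordv /lapse.
by case: (a == 0); case: (c == 0); field; rewrite ?u0 ?r0 ?k0.
Qed.

Lemma gammalE a : gammal a = 'i%C *: rgamma a :> 'M[R[i]]_4.
Proof. by rewrite rgammaE scalerA mulrN -expr2 sqr_i opprK scale1r. Qed.

Lemma gammauM a b : gammau a *m gammau b =
  - (eta a * eta b : R)%:C *: (rgamma a *m rgamma b).
Proof.
rewrite /gammau !gammalE; move: (rgamma a) (rgamma b) => A B.
rewrite !scalerA -scalemxAl -scalemxAr scalerA; congr (_ *: _).
by rewrite mulrACA -expr2 sqr_i rmorphM mulrN1.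
Qed.

(** The terms with b = c and those with a = c each assemble X next to gamma_c, in the two orders.
    The signs from raising indices cancel those of the spin connection, up to an eta that is 1
    because only spatial derivatives are nonzero. *)
Lemma spin_term p c psi : AdS p ->
  \sum_(a < 4) \sum_(b < 4) (spin_conn Lam p (frame Lam c p) a b)%:C *:
    (gammau a *m gammau b *m psi) =
  - ((spin_factor c p)%:C *:
     (dirX p *m (rgamma c *m psi) - rgamma c *m (dirX p *m psi))).
Proof.
move=> Ap.
(* The value of e_a(log [lapse c]), zero for a = 0 since the metric is static. *)
pose L a : R := if a == 0 then 0 else spin_factor c p * p 0 a.
have Y : \sum_(a < 4) (L a)%:C *: rgamma a = (spin_factor c p)%:C *: dirX p.
  rewrite scaler_sumr [RHS]big_mkcond; apply: eq_bigr => a _; rewrite /L.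
  by case: (a == 0); [rewrite scale0r | rewrite rmorphM scalerA].
transitivity (\sum_(a < 4) \sum_(b < 4)
    (- ((L a)%:C *: (rgamma a *m (rgamma b *m psi))) *+ (b == c)
     + ((L b)%:C *: (rgamma a *m (rgamma b *m psi))) *+ (a == c))).
  apply: eq_bigr => a _; apply: eq_bigr => b _.
  rewrite spin_connE // gammauM -scalemxAl scalerA -mulmxA.
  move: (rgamma a *m (rgamma b *m psi)) => V.
  transitivity ((- (L a *+ (b == c)) + L b *+ (a == c))%:C *: V).
    congr (_ *: _); rewrite -rmorphN -rmorphM; congr (_%:C).
    have [ebc|_] := eqVneq b c; have [eac|_] := eqVneq a c; subst;
    rewrite ?mulr1n ?mulr0n ?lapse_dlapse // /L /Defs.eta;
    do 2?case: (_ == 0); ring.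
  by case: (b == c); case: (a == c);
    rewrite ?mulr1n ?mulr0n ?oppr0 ?addr0 ?add0r ?rmorphD ?rmorphN ?scalerDl
      ?scaleNr ?scale0r.
have S1 (f : 'I_4 -> 'cV[R[i]]_4) : \sum_(b < 4) f b *+ (b == c) = f c.
  rewrite (bigD1 c) //= eqxx big1 ?addr0 // => b /negbTE bc.
  by rewrite bc mulr0n.
under eq_bigr do rewrite big_split /= S1.
rewrite big_split /= sumrN exchange_big /= (eq_bigr _ (fun b _ => S1 _)).
have YL V : \sum_(a < 4) (L a)%:C *: (rgamma a *m V) =
    (spin_factor c p)%:C *: (dirX p *m V).
  rewrite scalemxAl -Y mulmx_suml; apply: eq_bigr => a _.
  by rewrite scalemxAl.
transitivity (- ((spin_factor c p)%:C *: (dirX p *m (rgamma c *m psi)))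
    + rgamma c *m ((spin_factor c p)%:C *: (dirX p *m psi))).
  congr (- _ + _); first exact: YL.
  by rewrite -YL mulmx_sumr; apply: eq_bigr => a _; exact: scalemxAr.
by rewrite -(scalemxAr _ (rgamma c)) addrC -scalerBr -scalerN opprB.
Qed.

Section Algebra.
Variables (G X : 'M[R[i]]_4) (z : 'cV[R[i]]_4) (x r s k : R[i]).
Hypothesis XX : X *m X = r%:M.
Hypothesis XG : X *m G + G *m X = (2 * x)%:M.

Let XXz : X *m (X *m z) = r *: z.
Proof. by rewrite mulmxA XX mul_scalar_mx. Qed.

Let XGv (v : 'cV[R[i]]_4) : X *m (G *m v) = (2 * x) *: v - G *m (X *m v).
Proof. by rewrite !mulmxA -mul_scalar_mx -XG mulmxDl addrK. Qed.

Let XGXz : X *m (G *m (X *m z)) = (2 * x) *: (X *m z) - r *: (G *m z).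
Proof. by rewrite XGv XXz -scalemxAr. Qed.

(** The Killing equation along a spatial e_c, with G = [rgamma c], X = [dirX p], z the time-evolved
    spinor, x = x^c, r = rho^2 and s = [sconf p]. Moving X to the right of G by the anticommutator
    leaves combinations of z, Xz, Gz and GXz whose coefficients all cancel. *)
Lemma killing_space_id :
  (k * x * s) *: (z + X *m z) + s *: ((k * (1 - r)) *: (G *m z))
  + 4^-1 *: ((- (2 * k)) *:
      (X *m (G *m (s *: (z + X *m z))) - G *m (X *m (s *: (z + X *m z)))))
  + ('i%C * k) *: ('i%C *: G *m (s *: (z + X *m z))) = 0.
Proof.
have i2 : 'i%C * 'i%C = -1 :> R[i] by rewrite -expr2 sqr_i.
rewrite -!scalemxAl -!scalemxAr.
rewrite !mulmxDr XGXz XXz XGv -scalemxAr.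
move: (X *m z) (G *m z) (G *m (X *m z)) => y g w.
apply/matrixP => a b; rewrite !mxE.
have -> : 'i%C * k * ('i%C * (s * (g a b + w a b))) = - k * s * (g a b + w a b).
  by rewrite mulrACA i2; ring.
by field.
Qed.

(** The same along e_0, where X anticommutes with G. The coefficients cancel because (1 - r) + 2r =
    1 + r on Gz and -(1 - r) + 2 = 1 + r on GXz. *)
Lemma killing_time_id : x = 0 -> 1 + r != 0 ->
  s *: ((k * ((1 - r) / (1 + r))) *: (G *m z)
        + X *m ((k * ((1 - r) / (1 + r))) *: (G *m z)))
  + 4^-1 *: ((- (4 * k) / (1 + r)) *:
      (X *m (G *m (s *: (z + X *m z))) - G *m (X *m (s *: (z + X *m z)))))
  + ('i%C * k) *: ('i%C *: G *m (s *: (z + X *m z))) = 0.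
Proof.
move=> x0 r0; have i2 : 'i%C * 'i%C = -1 :> R[i] by rewrite -expr2 sqr_i.
rewrite -!scalemxAl -!scalemxAr !mulmxDr XGXz XXz XGv -scalemxAr x0.
move: (X *m z) (G *m z) (G *m (X *m z)) => y g w.
apply/matrixP => a b; rewrite !mxE.
have -> : 'i%C * k * ('i%C * (s * (g a b + w a b))) = - k * s * (g a b + w a b).
  by rewrite mulrACA i2; ring.
by field.
Qed.

End Algebra.

Lemma nabla_killing chi p c : AdS p -> nabla Lam (killing chi) p c = 0.
Proof.
move=> Ap; rewrite /nabla /spinD (dspinorE (is_cderive_killing chi _ Ap)).
rewrite spin_term // scalerN opprK killingE frameE gammalE.
rewrite dirXZ dirX_coordv xdotZ xdot_coordv mxE.
have XX := dirX2 p; have := dirX_anticomm p c; rewrite xdot_coordv.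
rewrite [coordv c 0 0]mxE eqxx andTb eq_sym.
have [->|c0] := eqVneq c 0; rewrite ?mulr0 => XG.
  (* Along e_0 neither the conformal factor nor X varies; only the time evolution is
     differentiated. *)
  rewrite !mul0r scale0r add0r scaler0 mul0mx add0r mulr1.
  have r0 : 1 + (rho2 p)%:C != 0.
    rewrite -(rmorph1 (real_complex R)) -rmorphD fmorph_eq0.
    by rewrite lt0r_neq0 // ltr_wpDr // rho2_ge0.
  move: (sconf p) => s; rewrite /lapse /spin_factor !eqxx !rmorphM !fmorphV
    rmorphN rmorphM.
  rewrite !rmorphD rmorphN !rmorph1.
  by apply: killing_time_id => //; rewrite mulr0.
rewrite !scale0r mulmx0 addr0 add0r.
(* One factor 1 - rho^2 of the frame absorbs two of the three powers produced by differentiating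
   [sconf]. *)
have -> : lapse Lam c p * p 0 c * sconf p ^+ 3 =
    adsk Lam * p 0 c * sconf p * (conf p * sconf p ^+ 2).
  by rewrite /lapse (negbTE c0) /conf; ring.
rewrite sconf2 // mulr1 /lapse /spin_factor (negbTE c0) -scalemxAl.
move: (sconf p) => s; rewrite !(rmorphM, rmorphN, rmorphB, rmorph1, rmorph_nat).
apply: killing_space_id => //.
by rewrite XG rmorphM rmorph_nat.
Qed.

End KillingSpinors.

(** * Antisymmetry of gamma^abc against repeated vectors *)

Section Contraction.
Context {R : realType}.
Implicit Types (a b c : 'I_4) (x y z : 'I_4 -> R).

Let alternating13 (A1 A2 A3 A4 A5 A6 : 'M[R[i]]_4) :
  A6 + A4 + A5 - A2 - A3 - A1 = - (A1 + A2 + A3 - A4 - A5 - A6).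
Proof. by apply/matrixP => i j; rewrite !mxE; ring. Qed.

Let alternating23 (A1 A2 A3 A4 A5 A6 : 'M[R[i]]_4) :
  A5 + A6 + A4 - A3 - A1 - A2 = - (A1 + A2 + A3 - A4 - A5 - A6).
Proof. by apply/matrixP => i j; rewrite !mxE; ring. Qed.

Lemma gamma3_swap13 a b c : gamma3 c b a = - gamma3 a b c :> 'M[R[i]]_4.
Proof.
by rewrite /gamma3 -scalerN; congr (_ *: _); exact: alternating13.
Qed.

Lemma gamma3_swap23 a b c : gamma3 a c b = - gamma3 a b c :> 'M[R[i]]_4.
Proof.
by rewrite /gamma3 -scalerN; congr (_ *: _); exact: alternating23.
Qed.

Definition contract3 x y z : 'M[R[i]]_4 :=
  \sum_(a < 4) \sum_(b < 4) \sum_(c < 4) (x a * y b * z c)%:C *: gamma3 a b c.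

Lemma oppr_eq_self0 (A : 'M[R[i]]_4) : A = - A -> A = 0.
Proof.
move=> AN; apply: (@scalerI _ _ (2 : R[i])); first by rewrite pnatr_eq0.
by rewrite scaler_nat mulr2n {1}AN addNr scaler0.
Qed.

(** Renaming a and c preserves the coefficients and reverses the sign of [gamma3], so the sum is its
    own opposite. *)
Lemma contract3_13 x y : contract3 x y x = 0.
Proof.
apply: oppr_eq_self0; rewrite {2}/contract3 exchange_big /=.
rewrite (eq_bigr _ (fun b _ => exchange_big _ _ _ _ _ _)) /= exchange_big /=.
rewrite -sumrN; apply: eq_bigr => a _; rewrite -sumrN; apply: eq_bigr => b _.
rewrite -sumrN; apply: eq_bigr => c _.
by rewrite (gamma3_swap13 a) scalerN opprK mulrAC (mulrC (x a)) mulrAC.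
Qed.

Lemma contract3_23 x y : contract3 x y y = 0.
Proof.
apply: oppr_eq_self0; rewrite -[RHS]sumrN; apply: eq_bigr => a _.
rewrite [LHS]exchange_big -sumrN; apply: eq_bigr => b _.
rewrite -sumrN; apply: eq_bigr => c _.
by rewrite gamma3_swap23 scalerN mulrAC.
Qed.

Lemma sum_contract3 x y z (u : 'rV[R[i]]_4) (v : 'cV[R[i]]_4) :
  \sum_(a < 4) \sum_(b < 4) \sum_(c < 4)
    (x a * y b * z c)%:C * (u *m gamma3 a b c *m v) 0 0 =
  (u *m contract3 x y z *m v) 0 0.
Proof.
rewrite mulmx_sumr mulmx_suml summxE; apply: eq_bigr => a _.
rewrite mulmx_sumr mulmx_suml summxE; apply: eq_bigr => b _.
rewrite mulmx_sumr mulmx_suml summxE; apply: eq_bigr => c _.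
by move: (gamma3 a b c) => G; rewrite -scalemxAr -scalemxAl [RHS]mxE.
Qed.

Lemma dirac_adjD (psi phi : 'cV[R[i]]_4) :
  dirac_adj (psi + phi) = dirac_adj psi + dirac_adj phi.
Proof. by rewrite /dirac_adj map_mxD linearD mulmxDl. Qed.

Lemma dirac_adjZ (r : R) (psi : 'cV[R[i]]_4) :
  dirac_adj (r%:C *: psi) = r%:C *: dirac_adj psi.
Proof.
rewrite /dirac_adj (_ : (map_mx _ _)^T = r%:C *: (map_mx (@conjc R) psi)^T).
  by rewrite scalemxAl.
apply/matrixP => i j; rewrite !mxE; case: (psi j i) => u v.
by rewrite /GRing.mul /= !mul0r !subr0 !addr0 -mulrN.
Qed.

(* Only derivatives tangent to S survive the contraction with l_a n_b. *)
Lemma contract_normal x y (phi psi A B A' B' : 'cV[R[i]]_4)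
    (D D' : 'I_4 -> 'cV[R[i]]_4) :
  (forall c, D c = (x c)%:C *: A + (y c)%:C *: B) ->
  (forall c, D' c = (x c)%:C *: A' + (y c)%:C *: B') ->
  \sum_(a < 4) \sum_(b < 4) \sum_(c < 4) (x a * y b)%:C *
    (dirac_adj phi *m gamma3 a b c *m D c
     - dirac_adj (D' c) *m gamma3 a b c *m psi) 0 0 = 0.
Proof.
move=> DE DE'.
transitivity (
  (dirac_adj phi *m contract3 x y x *m A) 0 0
  + (dirac_adj phi *m contract3 x y y *m B) 0 0
  - ((dirac_adj A' *m contract3 x y x *m psi) 0 0
  + (dirac_adj B' *m contract3 x y y *m psi) 0 0)); last first.
  by rewrite !contract3_13 !contract3_23 !(mulmx0, mul0mx) !mxE !addr0 subrr.
rewrite -!sum_contract3.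
do 3!(rewrite -!big_split -sumrN -big_split /=; apply: eq_bigr => ? _).
move: (gamma3 _ _ _) => G; rewrite DE DE' dirac_adjD !dirac_adjZ.
move: (dirac_adj phi) (dirac_adj A') (dirac_adj B') => u v w.
rewrite mulmxDr !mulmxDl -!scalemxAr -!scalemxAl.
rewrite !mxE !rmorphM.
by ring.
Qed.

End Contraction.

(** * Tangent vectors of the surface *)

Section Tangents.
Context {R : realType}.

Lemma diff_comp_app (U V W : normedModType R) (f : U -> V) (g : V -> W) x v :
  differentiable f x -> differentiable g (f x) ->
  'd (g \o f) x v = 'd g (f x) ('d f x v).
Proof. by move=> df dg; rewrite diff_comp. Qed.

Implicit Types (p v w : 'rV[R]_4) (S : set 'rV[R]_4).

Lemma tangent_derive0 S p v (f : 'rV[R]_4 -> R) :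
  S p -> tangent_at S p v -> differentiable f p ->
  (forall q, S q -> f q = 0) -> 'D_v f p = 0.
Proof.
move=> Sp [c [c0 [dc Dc] Sc]] df f0.
have dcd : differentiable c 0 by exact/derivable1_diffP.
rewrite -c0 in df; have dfc : differentiable (f \o c) 0.
  exact: differentiable_comp.
have -> : 'D_v f p = 'D_1 (f \o c) 0.
  rewrite [RHS]deriveE // diff_comp //= -[X in _ = 'd f _ X]deriveE // Dc.
  by rewrite -deriveE // c0.
have dD : derivable (f \o c) 0 1 by exact: diff_derivable.
(* The curve is known to lie in S only for small positive times. As the derivative exists, it may be
   computed as a limit from the right, where the quotient is zero. *)
rewrite /derive (cvg_at_rightE _ _ dD); apply/cvg_lim => //.
apply: cvg_near_cst; near=> h.
rewrite /= c0 (f0 p) // subr0 addr0 /GRing.scale /= mulr1 f0 ?mulr0 //.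
by near: h.
Unshelve. all: by end_near. Qed.

(** The curve is the image under phi of the line through [psi p] in direction e, which stays on the
    edge x^0 = x^3 = 0 of the chart. *)
Lemma coord_curve_tangent S p (U W : set 'rV[R]_4)
    (psi phi : 'rV[R]_4 -> 'rV[R]_4) (e : 'rV[R]_4) : S p -> open W ->
  smooth W phi -> U p -> psi @` U = W -> phi @` W = U ->
  (forall q, U q -> phi (psi q) = q) ->
  (forall x, W x -> psi (phi x) = x) ->
  (forall q, U q -> (S q <-> psi q 0 0 = 0 /\ psi q 0 (inord 3) = 0)) ->
  e 0 0 = 0 -> e 0 (inord 3) = 0 ->
  tangent_at S p ('d phi (psi p) e).
Proof.
move=> Sp oW sphi Up psiU phiW phiK psiK Schart e0 e3.
have Wp : W (psi p) by rewrite -psiU; exists p.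
have dphi : differentiable phi (psi p) by have [d _] := sphi 1%N; exact: d.
pose l : R -> 'rV[R]_4 := ( *:%R^~ e) + cst (psi p).
have l0 : l 0 = psi p by rewrite /l !fctE scale0r add0r.
have [dl Dl] : is_diff (0 : R) l (( *:%R^~ e) + 0).
  have ds : is_diff (0 : R) ( *:%R^~ e) ( *:%R^~ e) by exact: is_diff_scalel.
  have dc : is_diff (0 : R) (cst (psi p)) 0 by exact: is_diff_cst.
  exact: is_diffD.
have dphil : differentiable phi (l 0) by rewrite l0.
exists (phi \o l); split.
- by rewrite /= l0 phiK.
- have dc : differentiable (phi \o l) 0 by exact: differentiable_comp.
  split; first exact: diff_derivable.
  by rewrite deriveE // diff_comp //= Dl l0 /= !fctE scale1r addr0.
- apply: cvg_within.
  have Wl : \forall t \near (0 : R), W (l t).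
    apply: (differentiable_continuous dl); rewrite l0.
    exact: open_nbhs_nbhs.
  apply: filterS Wl => t Wt /=; apply/Schart; first by rewrite -phiW; exists (l
    t).
  rewrite psiK // !mxE e0 e3 mulr0 !add0r.
  by have /Schart[] := Sp.
Qed.

(** The images under d phi of the two coordinate directions along the edge. They are independent
    because d psi is a left inverse of d phi. *)
Lemma surface_tangents Sigma S p :
  hypersurface_with_boundary Sigma S -> S p -> exists t1 t2,
  [/\ tangent_at S p t1, tangent_at S p t2 &
      forall a b : R, a *: t1 + b *: t2 = 0 -> a = 0 /\ b = 0].
Proof.
move=> [SSigma chart] Sp.
have [U [W [psi [phi [[oU oW Up spsi sphi] [psiU phiW phiK psiK] _ Schart]]]]]
  :=
  chart p (SSigma p Sp).
pose e1 : 'rV[R]_4 := delta_mx 0 1; pose e2 : 'rV[R]_4 := delta_mx 0 2.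
have i3 : inord 3 = 3 :> 'I_4 by apply: val_inj; rewrite /= inordK.
exists ('d phi (psi p) e1), ('d phi (psi p) e2).
split; try by apply: (coord_curve_tangent Sp oW sphi Up psiU phiW phiK psiK
  Schart);
  rewrite ?i3 mxE.
have Wp : W (psi p) by rewrite -psiU; exists p.
have dphi : differentiable phi (psi p) by have [d _] := sphi 1%N; exact: d.
have dpsi : differentiable psi (phi (psi p)).
  by rewrite phiK //; have [d _] := spsi 1%N; exact: d.
have dK v : 'd psi (phi (psi p)) ('d phi (psi p) v) = v.
  rewrite -diff_comp_app //.
  rewrite -deriveE; last exact: differentiable_comp.
  rewrite (@near_eq_derive _ _ _ (psi \o phi) id) ?derive_id //.
  near=> x; apply: psiK; near: x; exact: open_nbhs_nbhs.
move=> a b t0.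
have E0 : 'd phi (psi p) (a *: e1 + b *: e2) = 0 by rewrite linearD !linearZ.
have := congr1 ('d psi (phi (psi p))) E0; rewrite dK => E0'.
have d0 : 'd psi (phi (psi p)) 0 = 0 by exact: linear0.
have /rowP E : a *: e1 + b *: e2 = 0 by rewrite E0' d0.
by have := E 1; have := E 2; rewrite !mxE /= !(mulr0, mulr1, addr0, add0r).
Unshelve. all: by end_near. Qed.

End Tangents.

(** * Derivatives of spinor fields that agree on the surface *)

Section NormalDerivatives.
Context {R : realType} (Lam : R) (hLam : Lam < 0).
Implicit Types (p u v w t : 'rV[R]_4) (S Sigma : set 'rV[R]_4).

Lemma gdotC p v w : gdot Lam p v w = gdot Lam p w v.
Proof. by rewrite !gdotE //; apply: eq_bigr => a _; rewrite mulrAC. Qed.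

Lemma gdotDr p u v w : gdot Lam p u (v + w) = gdot Lam p u v + gdot Lam p u w.
Proof. by rewrite /gdot linearD mulmxDr mxE. Qed.

Lemma gdotZr p u v (r : R) : gdot Lam p u (r *: v) = r * gdot Lam p u v.
Proof. by rewrite /gdot linearZ -scalemxAr mxE. Qed.

Lemma gdotDl p u v w : gdot Lam p (v + w) u = gdot Lam p v u + gdot Lam p w u.
Proof. by rewrite !(gdotC p _ u) gdotDr. Qed.

Lemma gdotZl p u v (r : R) : gdot Lam p (r *: v) u = r * gdot Lam p v u.
Proof. by rewrite !(gdotC p _ u) gdotZr. Qed.

Lemma normal_decomposition p t1 t2 (P Q v : 'rV[R]_4) :
  (forall a b : R, a *: t1 + b *: t2 = 0 -> a = 0 /\ b = 0) ->
  gdot Lam p P P = -1 -> gdot Lam p Q Q = 1 -> gdot Lam p P Q = 0 ->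
  gdot Lam p P t1 = 0 -> gdot Lam p P t2 = 0 ->
  gdot Lam p Q t1 = 0 -> gdot Lam p Q t2 = 0 ->
  exists a b : R, v = a *: t1 + b *: t2
    + (- gdot Lam p P v) *: P + gdot Lam p Q v *: Q.
Proof.
move=> free PP QQ PQ Pt1 Pt2 Qt1 Qt2.
have QP : gdot Lam p Q P = 0 by rewrite gdotC.
(* These four rows form a basis: pairing a vanishing combination with Q and P kills the last two
   coefficients, and independence of t1, t2 kills the others. The same pairings give the normal
   coefficients of v. *)
pose M : 'M[R]_4 := \matrix_(i < 4) nth 0 [:: t1; t2; P; Q] i.
have xM (x : 'rV[R]_4) : x *m M =
    x 0 0 *: t1 + x 0 1 *: t2 + x 0 2 *: P + x 0 3 *: Q.
  rewrite mulmx_sum_row !big_ord_recl big_ord0 addr0 !rowK /= !addrA.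
  by do !congr (_ + _); congr (x _ _ *: _); apply: val_inj.
have gP (x : 'rV[R]_4) : gdot Lam p P (x *m M) = - x 0 2.
  by rewrite xM !gdotDr !gdotZr Pt1 Pt2 PP PQ; ring.
have gQ (x : 'rV[R]_4) : gdot Lam p Q (x *m M) = x 0 3.
  by rewrite xM !gdotDr !gdotZr Qt1 Qt2 QP QQ; ring.
have uM : M \in unitmx.
  rewrite -row_free_unit; apply: inj_row_free => x xM0.
  have g0 u : gdot Lam p u 0 = 0 by rewrite -(scale0r 0) gdotZr mul0r.
  have x3 : x 0 3 = 0 by rewrite -gQ xM0 g0.
  have x2 : x 0 2 = 0 by apply/eqP; rewrite -oppr_eq0 -gP xM0 g0.
  have [x0 x1] : x 0 0 = 0 /\ x 0 1 = 0.
    by apply: free; rewrite -xM0 xM x2 x3 !scale0r !addr0.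
  apply/rowP => -[[|[|[|[|]]]] // i4]; rewrite [RHS]mxE.
  - by rewrite -x0; congr (x _ _); apply: val_inj.
  - by rewrite -x1; congr (x _ _); apply: val_inj.
  - by rewrite -x2; congr (x _ _); apply: val_inj.
  - by rewrite -x3; congr (x _ _); apply: val_inj.
have vE : v = (v *m invmx M) *m M by rewrite mulmxKV.
have Pv : gdot Lam p P v = - (v *m invmx M) 0 2 by rewrite {1}vE gP.
have Qv : gdot Lam p Q v = (v *m invmx M) 0 3 by rewrite {1}vE gQ.
exists ((v *m invmx M) 0 0), ((v *m invmx M) 0 1).
by rewrite Pv Qv opprK -xM.
Qed.

Definition spinor_diff (F : 'rV[R]_4 -> 'cV[R[i]]_4) p : Prop := forall i,
  differentiable (fun q => complex.Re (F q i 0)) p /\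
  differentiable (fun q => complex.Im (F q i 0)) p.

Lemma spinor_field_diff S F p : spinor_field S F -> S p -> spinor_diff F p.
Proof.
move=> SF Sp i; have [[U [oU SU sU]] [U' [oU' SU' sU']]] := SF i.
have [dU _] := sU 1%N; have [dU' _] := sU' 1%N.
by split; [exact/dU/SU|exact/dU'/SU'].
Qed.

Lemma derive_linear (V : normedModType R) (f : V -> R) x (r : R) y z :
  differentiable f x -> 'D_(r *: y + z) f x = r * 'D_y f x + 'D_z f x.
Proof. by move=> df; rewrite !deriveE // linearP. Qed.

Lemma dspinorP F p (r : R) u v : spinor_diff F p ->
  dspinor F p (r *: u + v) = r%:C *: dspinor F p u + dspinor F p v.
Proof.
move=> dF; apply/matrixP => i j; have [dR dI] := dF i; rewrite !mxE.
rewrite !derive_linear //.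
by apply/eqP; rewrite eq_complex /= !mul0r subr0 addr0 !eqxx.
Qed.

Lemma dspinor_tangent S F G p t : spinor_diff F p -> spinor_diff G p ->
  S p -> (forall q, S q -> F q = G q) -> tangent_at S p t ->
  dspinor F p t = dspinor G p t.
Proof.
move=> dF dG Sp FG tS; apply/matrixP => i j; rewrite !mxE.
have [dRF dIF] := dF i; have [dRG dIG] := dG i.
congr (_ +i* _); apply: subr0_eq.
  rewrite -deriveB; [|exact: diff_derivable|exact: diff_derivable].
  apply: (tangent_derive0 Sp tS); first exact: differentiableB.
  by move=> q Sq; rewrite !fctE FG // subrr.
rewrite -deriveB; [|exact: diff_derivable|exact: diff_derivable].
apply: (tangent_derive0 Sp tS); first exact: differentiableB.
by move=> q Sq; rewrite !fctE FG // subrr.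
Qed.

(** The change from (P, Q) to the null pair with s = 1 / sqrt 2: for x, y the c-components of P and
    Q, s (x + y) and s (x - y) are l_c and n_c. *)
Lemma null_recombine (s x y : R) (A B : 'cV[R[i]]_4) : s * s * 2 = 1 ->
  (- x)%:C *: A + y%:C *: B = (s * (x + y))%:C *: (s%:C *: (B - A))
    + (s * (x - y))%:C *: ((- s)%:C *: (A + B)).
Proof.
move=> s2; apply/matrixP => i j; rewrite !mxE.
move: (A i j) (B i j) => [a a'] [b b'].
by apply/eqP; rewrite eq_complex /=; apply/andP; split; apply/eqP;
  rewrite -[LHS]mul1r -s2; ring.
Qed.

(** The difference F - G vanishes on S, so its differential at p kills the tangent plane of S and
    factors through the span of P and Q. Since G is parallel for [nabla] at p, this differential is
    all of [nabla] F there. *)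
Lemma nabla_normal Sigma S (P Q : 'rV[R]_4 -> 'rV[R]_4) F G p :
  hypersurface_with_boundary Sigma S ->
  future_unit_normal Lam Sigma S P -> outward_unit_normal Lam Sigma S Q ->
  S p -> spinor_diff F p -> spinor_diff G p ->
  (forall q, S q -> F q = G q) -> (forall c, nabla Lam G p c = 0) ->
  exists A B : 'cV[R[i]]_4, forall c, nabla Lam F p c =
    (lowc Lam p (null_l P Q p) c)%:C *: A + (lowc Lam p (null_n P Q p) c)%:C *:
      B.
Proof.
move=> hyp [_ hP] [_ hQ] Sp dF dG FG nG.
have [t1 [t2 [T1 T2 free]]] := surface_tangents hyp Sp.
have SSigma t : tangent_at S p t -> tangent_at Sigma p t.
  move=> [c [c0 Dc Sc]]; exists c; split=> //.
  by apply: filterS Sc => h Sh; exact: (proj1 hyp).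
have [PP _ Ptan] := hP p Sp; have [QQ mQ Qtan] := hQ p Sp.
(* The vector [- Q p] points into Sigma and so is tangent to it in the sense of [tangent_at], whence
   P is orthogonal to it. *)
have PQ : gdot Lam p (P p) (Q p) = 0.
  by have := Ptan _ mQ; rewrite -scaleN1r gdotZr mulN1r => /eqP; rewrite
    oppr_eq0 => /eqP.
pose E v := dspinor F p v - dspinor G p v.
have EP (r : R) u v : E (r *: u + v) = r%:C *: E u + E v.
  by rewrite /E !dspinorP // scalerBr opprD addrACA.
have E0 t : tangent_at S p t -> E t = 0.
  by move=> tS; rewrite /E (dspinor_tangent dF dG Sp FG tS) subrr.
have EE v : E v = (- gdot Lam p (P p) v)%:C *: E (P p)
                  + (gdot Lam p (Q p) v)%:C *: E (Q p).
  have [a [b vE]] := normal_decomposition v free PP QQ PQ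
    (Ptan _ (SSigma _ T1)) (Ptan _ (SSigma _ T2)) (Qtan _ T1) (Qtan _ T2).
  have E00 : E 0 = 0.
    have := EP 1 0 0; rewrite scaler0 addr0 scale1r => /esym/eqP.
    by rewrite -subr_eq0 addrK => /eqP.
  rewrite {1}vE -[_ *: Q p in LHS]addr0 -!addrA !EP (E0 _ T1) (E0 _ T2) E00.
  by move: (E (P p)) (E (Q p)) => A B; rewrite !scaler0 !add0r addr0.
pose s : R := (Num.sqrt 2)^-1.
have s2 : s * s * 2 = 1.
  by rewrite -invfM -expr2 sqr_sqrtr ?ler0n // mulVf ?pnatr_eq0.
exists (s%:C *: (E (Q p) - E (P p))), ((- s)%:C *: (E (P p) + E (Q p))) => c.
have -> : nabla Lam F p c = E (frame Lam c p).
  (* The spin connection term and the i k gamma_c term depend only on the value at p, which F and G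
     share. *)
  have cancel (a b x y : 'cV[R[i]]_4) : a - x + y - (b - x + y) = a - b.
    by rewrite opprD addrACA subrr addr0 opprD addrACA opprK addNr addr0.
  by rewrite -[LHS]subr0 -(nG c) /nabla /spinD FG // cancel.
rewrite EE /lowc /null_l /null_n -/s -(scaleN1r (Q p)) !gdotZl !gdotDl gdotZl.
rewrite mulN1r.
exact: null_recombine.
Qed.

End NormalDerivatives.

(** * Genericity and the vanishing of the mass *)

Lemma killing_mbar_equation (R : realType) (Lam : R) (S : set 'rV[R]_4)
    (P Q : 'rV[R]_4 -> 'rV[R]_4) orient chi :
  Lam < 0 -> S `<=` @AdS R ->
  mbar_equation Lam S P Q orient (killing Lam chi).
Proof.
move=> hLam SA; split=> [i|p X Y Sp _].
  by split; exists (@AdS R); split=> //; try exact: open_AdS;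
    move=> n; have [] := cCn_killing Lam chi n i.
by apply: big1 => a _; rewrite nabla_killing ?scaler0 //; exact: SA.
Qed.

Lemma generic_basis_killing (R : realType) (Lam : R) (S : set 'rV[R]_4)
    (P Q : 'rV[R]_4 -> 'rV[R]_4) orient Phi :
  Lam < 0 -> S `<=` @AdS R -> generic_basis Lam S P Q orient Phi ->
  forall B, exists chi, forall p, S p -> Phi B p = killing Lam chi p.
Proof.
move=> hLam SA [_ _ span [p0 Sp0 indep]] B.
(* The Killing spinor is matched to [Phi B] at the single point p0 where the basis is
   independent. *)
have [chi chiE] := killing_onto Lam (Phi B p0) (SA _ Sp0).
have [z zE] := span _ (killing_mbar_equation P Q orient chi hLam SA).
exists chi => p Sp.
(* Its coefficients in the basis are constants, so comparing at p0 fixes them as Kronecker deltas,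
   and the equality with [Phi B] holds on all of S. *)
have zB A : z A - (A == B)%:R = 0.
  apply: (indep (fun A => z A - (A == B)%:R)).
  rewrite (eq_bigr _ (fun A _ => scalerBl _ _ _)) sumrB -zE // chiE.
  rewrite (bigD1 B) //= eqxx scale1r big1 ?addr0 ?subrr // => C /negbTE ->.
  by rewrite scale0r.
rewrite zE // (bigD1 B) //= big1 ?addr0 => [|A AB].
  by have /subr0_eq -> := zB B; rewrite eqxx scale1r.
by have /subr0_eq -> := zB A; rewrite (negbTE AB) scale0r.
Qed.

Lemma cintegral_eq0 (R : realType) (mu : {measure set (@borel4 R) -> \bar R})
    (S : set 'rV[R]_4) (f : 'rV[R]_4 -> R[i]) :
  (forall p, S p -> f p = 0) -> cintegral mu S f = 0.
Proof.
move=> f0; have I0 (g : borel4 -> R) : (forall p, S p -> g p = 0) ->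
    Rintegral mu S g = 0.
  move=> g0; rewrite (@eq_Rintegral _ _ _ mu S (cst 0)) ?Rintegral_cst0 //.
    by rewrite /Rintegral integral0.
  by move=> p /set_mem /g0.
rewrite /cintegral (I0 (fun p => complex.Re (f p))) => [|p /f0 -> //].
by rewrite (I0 (fun p => complex.Im (f p))) // => p /f0 ->.
Qed.

Theorem lemma4p10 (R : realType) (Lam : R) (hLam : Lam < 0)
    (Sigma S : set 'rV[R]_4)
    (hSigma : compact_spacelike_with_boundary Lam Sigma S)
    (hS : connected S)
    (P Q : 'rV[R]_4 -> 'rV[R]_4) (orient : bool)
    (hP : future_unit_normal Lam Sigma S P)
    (hQ : outward_unit_normal Lam Sigma S Q)
    (htheta : forall p X Y, S p -> adapted Lam S P Q orient p X Y ->
       [/\ 0 < expansion Lam (null_l P Q) p X Y,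
           expansion Lam (null_n P Q) p X Y < 0 &
           expansion Lam (null_l P Q) p X Y * expansion Lam (null_n P Q) p X Y
             < (- 8 * adsk Lam ^+ 2)%:C])
    (mu : {measure set (@borel4 R) -> \bar R}) (hmu : area_measure Lam S mu)
    (Phi : 'I_4 -> 'rV[R]_4 -> 'cV[R[i]]_4)
    (hPhi : generic_basis Lam S P Q orient Phi) :
  forall p, S p -> quasilocal_mass Lam S mu P Q Phi p = 0.
Proof.
have SA : S `<=` @AdS R.
  by case: hSigma => SigmaA _ [SSigma _] _ q /SSigma/SigmaA.
have hyp : hypersurface_with_boundary Sigma S by case: hSigma.
have Q0 : Qmx Lam S mu P Q Phi = 0.
  apply/matrixP => A B; rewrite mxE [RHS]mxE; apply: cintegral_eq0 => p Sp.
  have hN C : exists U V : 'cV[R[i]]_4, forall c, nabla Lam (Phi C) p c =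
      (lowc Lam p (null_l P Q p) c)%:C *: U + (lowc Lam p (null_n P Q p) c)%:C
        *: V.
    have [chi chiE] := generic_basis_killing hLam SA hPhi C.
    have [eqPhi _ _ _] := hPhi.
    have [kS _] := killing_mbar_equation P Q orient chi hLam SA.
    apply: (nabla_normal hLam hyp hP hQ Sp _ _ chiE).
    - exact: (spinor_field_diff (proj1 (eqPhi C)) Sp).
    - exact: (spinor_field_diff kS Sp).
    - by move=> c; apply: nabla_killing => //; exact: SA.
  have [U [V UV]] := hN B; have [U' [V' UV']] := hN A.
  exact: (contract_normal _ _ UV UV').
move=> p Sp; rewrite /quasilocal_mass Q0.
by rewrite !mul0mx mxtrace0 oppr0 sqrtC0 mulr0.
Qed.
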